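(* Let $U$ be the space of polarized lattices of type $\Psi_0$ in $V_0$ satisfying P1, P2 and P3, with its right action of $G_0=\mathrm{Aut}(V_0,F_0^\bullet,\psi_0)$. Let $D$ be the Griffiths domain associated with a fixed polarized lattice $x_0$ of type $\Psi_0$ in $V_0$, with its action of $\Gamma_{\mathbb Z}=\mathrm{Aut}(V_{\mathbb Z}(x_0),\psi_{\mathbb Z}(x_0))$ (all notions as defined in the context). Then there is a canonical isomorphism $$\beta: U/G_0\ \xrightarrow{\ \sim\ }\ \Gamma_{\mathbb Z}\backslash D .$$ It is induced by the map sending $x\in U$ to the class of $\gamma(F_0^\bullet)$, where $\gamma:(V_{\mathbb Z}(x),\psi_{\mathbb Z}(x))\to(V_{\mathbb Z}(x_0),\psi_{\mathbb Z}(x_0))$ is any isomorphism of polarized lattices and $\gamma(F_0^\bullet)$ is the push-forward of $F_0^\bullet$ under (the $\mathbb C$-linear extension of) $\gamma$.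
   Context: Fix a $\mathbb C$-vector space $V_0$ of dimension $h$, a natural number $m$, and an $h\times h$ integer matrix $\Psi_0$ such that the bilinear form $\mathbb Z^h\times\mathbb Z^h\to\mathbb Z$, $(a,b)\mapsto a^{t}\Psi_0 b$, is symmetric if $m$ is even, skew if $m$ is odd, and non-degenerate in the sense that $\mathbb Z^h\to(\mathbb Z^h)^\vee$, $a\mapsto(b\mapsto a^{t}\Psi_0 b)$, is an isomorphism of $\mathbb Z$-modules. Polarized lattices. A lattice in $V_0$ is a $\mathbb Z$-module generated by a $\mathbb C$-basis of $V_0$. A polarized lattice of type $\Psi_0$ in $V_0$ is a lattice $V_{\mathbb Z}\subset V_0$ together with a bilinear map $\psi_{\mathbb Z}:V_{\mathbb Z}\times V_{\mathbb Z}\to\mathbb Z$ whose matrix in some $\mathbb Z$-basis of $V_{\mathbb Z}$ is $\Psi_0$. Let $\mathcal L$ be the set of polarized lattices of type $\Psi_0$ in $V_0$; it has a canonical structure of a complex manifold of dimension $h^2$, local charts around a point being obtained by fixing a basis of the $\mathbb Z$-module $V_{\mathbb Z}$. For $x\in\mathcal L$ write $(V_{\mathbb Z}(x),\psi_{\mathbb Z}(x))$ for the corresponding lattice and form, and $\psi_{\mathbb C}(x):V_0\times V_0\to\mathbb C$ for the $\mathbb C$-bilinear extension of $\psi_{\mathbb Z}(x)$. Conjugation with respect to $x$: if $V_{\mathbb Z}(x)=\sum_{i=1}^h\mathbb Z\delta_i$ and $\omega=\sum_i a_i\delta_i$ with $a_i\in\mathbb C$, then $\overline{\omega}^x:=\sum_i\overline{a_i}\,\delta_i$.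 An isomorphism of polarized lattices is an isomorphism of $\mathbb Z$-modules respecting the bilinear forms. Hodge data. Fix integers $h^{i,m-i}\ge 0$ ($0\le i\le m$), put $h^i:=\sum_{j=i}^m h^{j,m-j}$, with $h^0=h$. Fix a filtration $F_0^\bullet:\{0\}=F_0^{m+1}\subset F_0^m\subset\cdots\subset F_0^1\subset F_0^0=V_0$ with $\dim F_0^i=h^i$, and a bilinear form $\psi_0:V_0\times V_0\to\mathbb C$ whose matrix in some basis of $V_0$ is $\Psi_0$ and which satisfies $\psi_0(F_0^i,F_0^j)=0$ whenever $i+j>m$. For $x\in\mathcal L$ put $H^{i,m-i}(x):=F_0^i\cap\overline{F_0^{m-i}}^x$. Consider the properties: P1: $\psi_{\mathbb C}(x)=\psi_0$; P2: $V_0=\bigoplus_{i=0}^m H^{i,m-i}(x)$; P3: $(-1)^{\frac{m(m-1)}2+i}(\sqrt{-1})^{-m}\,\psi_{\mathbb C}(x)(\omega,\overline{\omega}^x)>0$ for all $i$ and all nonzero $\omega\in H^{i,m-i}(x)$. Let $U:=\{x\in\mathcal L: x\text{ satisfies P1, P2, P3}\}$. It is an open subset of the analytic subset $\{x\in\mathcal L: x\text{ satisfies P1}\}$ of $\mathcal L$. The group $G_0$. $G_0=\mathrm{Aut}(V_0,F_0^\bullet,\psi_0)$ is the algebraic group of linear maps $g:V_0\to V_0$ with $g(F_0^i)=F_0^i$ for all $i$ and $\psi_0(g(\omega_1),g(\omega_2))=\psi_0(\omega_1,\omega_2)$ for all $\omega_1,\omega_2\in V_0$. It acts on $\mathcal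 L$ from the right by $V_{\mathbb Z}(xg):=g^{-1}(V_{\mathbb Z}(x))$, $\psi_{\mathbb Z}(xg)(\cdot,\cdot):=\psi_{\mathbb Z}(x)(g(\cdot),g(\cdot))$, and this action preserves $U$. Griffiths domain. The space of all filtrations $F^\bullet:\{0\}=F^{m+1}\subset F^m\subset\cdots\subset F^0=V_0$ with $\dim F^i=h^i$ has a natural structure of a compact smooth projective variety. Fix $x_0\in\mathcal L$. $D$ is the subset of those filtrations $F^\bullet$ for which $(V_{\mathbb Z}(x_0),\psi_{\mathbb Z}(x_0),F^\bullet)$ is a polarized Hodge structure (of weight $m$), i.e. $\psi_{\mathbb C}(x_0)(F^i,F^j)=0$ for $i+j>m$ and, with $H^{i,m-i}:=F^i\cap\overline{F^{m-i}}^{x_0}$, one has $V_0=\bigoplus_{i=0}^m H^{i,m-i}$ and $(-1)^{\frac{m(m-1)}2+i}(\sqrt{-1})^{-m}\psi_{\mathbb C}(x_0)(\omega,\overline{\omega}^{x_0})>0$ for all $i$ and $0\neq\omega\in H^{i,m-i}$. The group $\Gamma_{\mathbb Z}:=\mathrm{Aut}(V_{\mathbb Z}(x_0),\psi_{\mathbb Z}(x_0))$ acts on $V_0$ in the usual way ($\mathbb C$-linear extension), and this gives an action of $\Gamma_{\mathbb Z}$ on $D$; the quotient $\Gamma_{\mathbb Z}\backslash D$ is the moduli space of polarized Hodge structures of the given type. *)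

(* Defs.v *)
From HB Require Import structures.
From mathcomp Require Import all_boot all_order all_algebra complex.
From mathcomp Require Import all_classical all_reals all_analysis.

Set Implicit Arguments.
Unset Strict Implicit.
Unset Printing Implicit Defensive.
Import Order.TTheory GRing.Theory Num.Theory numFieldNormedType.Exports.
Local Open Scope classical_set_scope.
Local Open Scope ring_scope.

(* The topology of R[i] given by its norm, as for any numFieldType. *)
HB.instance Definition _ (R : realType) :=
  NormedModule.copy R[i] (R[i] : numFieldType)^o.

(* A set with a topology and a sheaf of complex-valued functions; copen and
   chol are only meaningful for subsets of supp, and chol A f only depends on
   the restriction of f to A. *)
Record cspace (R : realType) := CSpace {
  pts : Type;
  supp : set pts;
  copen : set (set pts);
  chol : set pts -> (pts -> R[i]) -> Prop
}.
Arguments supp {R} c _.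
Arguments copen {R} c A.
Arguments chol {R} c A f.

Section Spaces.
Variable R : realType.
Local Notation C := R[i].

(* The quotient of X by the partition whose classes are the sets orb x. *)
Definition quot_space (X : cspace R) (orb : pts X -> set (pts X)) : cspace R :=
  @CSpace R (set (pts X)) [set orb x | x in supp X]
    (fun A => A `<=` [set orb x | x in supp X] /\
              copen X (supp X `&` orb @^-1` A))
    (fun A f => chol X (supp X `&` orb @^-1` A) (f \o orb)).

Definition analytic_iso (X Y : cspace R) (b : pts X -> pts Y) : Prop :=
  [/\ set_bij (supp X) (supp Y) b,
      forall A, A `<=` supp Y -> copen Y A <-> copen X (supp X `&` b @^-1` A) &
      forall A f, copen Y A -> chol Y A f <-> chol X (supp X `&` b @^-1` A) (f \o b)].

Variables (V : vectType C) (h : nat).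

(* The linear identification of matrices with h-tuples of vectors of V; the
   induced topology and holomorphic functions on tuples do not depend on the
   basis of V that is used. *)
Definition frame (M : 'M[C]_(h, \dim {:V})) : h.-tuple V :=
  [tuple \sum_(j < \dim {:V}) M i j *: (vbasis {:V})`_j | i < h].

(* The subspace S of a complex manifold T that is described by bases of V:
   k d t means that the basis d represents the point t. It is used when
   d |-> t is a surjective holomorphic submersion onto T (a local biholomorphism
   for lattices; for flags, the analogue of homogeneous coordinates). Hence T
   has the quotient topology, S the subspace topology, and a function on a
   subset of S is holomorphic when, in these coordinates, it is locally the
   restriction of a holomorphic (complex differentiable) function. *)
Definition coord_space (T : Type) (k : h.-tuple V -> T -> Prop) (S : set T) :
    cspace R :=
  @CSpace R T S
    (fun A => exists2 O : set T,
       open [set M | exists2 t, k (frame M) t & O t] & A = S `&` O)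
    (fun A f => forall M t, k (frame M) t -> A t ->
       exists (B : set 'M[C]_(h, \dim {:V})) (g : 'M[C]_(h, \dim {:V}) -> C^o),
         [/\ open B, B M, (forall N, B N -> differentiable g N) &
             forall N s, B N -> k (frame N) s -> A s -> f s = g N]).

End Spaces.

Section IntegralForm.
Variables (h : nat) (Psi : 'M[int]_h).

Definition intform (a b : 'cV[int]_h) : int := (a^T *m Psi *m b) 0 0.

Definition int_nondegenerate : Prop :=
  forall phi : {additive 'cV[int]_h -> int},
    exists! a : 'cV[int]_h, forall b, phi b = intform a b.

End IntegralForm.

Record zform (V : Type) := ZForm { lat : set V; form : V -> V -> int }.

Section Lattices.
Variables (R : realType) (V : vectType R[i]) (h : nat).
Local Notation C := R[i].
Implicit Types (x y : zform V) (d : h.-tuple V) (g : V -> V) (u v w : V).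

Definition zbasis x d : Prop :=
  basis_of {:V} d /\
  lat x = [set v | exists a : 'I_h -> int, v = \sum_(i < h) d`_i *~ a i].

(* The form of a polarized lattice is only defined on lat x; it is extended by
   0 so that equal polarized lattices are equal records. *)
Definition polarized_lattice (Psi : 'M[int]_h) : set (zform V) := [set x |
  [/\ exists2 d, zbasis x d & forall i j : 'I_h, form x d`_i d`_j = Psi i j,
      forall u v w, lat x u -> lat x v -> lat x w ->
        form x (u + v) w = form x u w + form x v w,
      forall u v w, lat x u -> lat x v -> lat x w ->
        form x u (v + w) = form x u v + form x u w &
      forall u v, ~ (lat x u /\ lat x v) -> form x u v = 0]].

(* A chosen Z-basis; the constructions below do not depend on the choice. *)
Definition zb x : h.-tuple V := xget (nseq_tuple h 0) [set d | zbasis x d].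

Definition psiC x u v : C :=
  \sum_(i < h) \sum_(j < h)
    coord (zb x) i u * coord (zb x) j v * (form x (zb x)`_i (zb x)`_j)%:~R.

Definition lconj x v : V := \sum_(i < h) (coord (zb x) i v)^* *: (zb x)`_i.

(* The image of U under the antilinear map lconj x. *)
Definition conjv x (U : {vspace V}) : {vspace V} :=
  <<[seq lconj x u | u <- vbasis U]>>%VS.

(* Values of g outside of lat x are irrelevant, also in lext x g. *)
Definition lattice_isom x y g : Prop :=
  [/\ set_bij (lat x) (lat y) g,
      forall u v, lat x u -> lat x v -> g (u + v) = g u + g v &
      forall u v, lat x u -> lat x v -> form y (g u) (g v) = form x u v].

Definition lext x g : 'End(V) :=
  linfun (fun v => \sum_(i < h) coord (zb x) i v *: g (zb x)`_i).

Definition act x (f : 'End(V)) : zform V :=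
  ZForm (f @^-1` lat x) (fun u v => form x (f u) (f v)).

End Lattices.

Section Hodge.
Variables (R : realType) (V : vectType R[i]) (h m : nat).
Variable hn : nat -> nat. (* hn i is the Hodge number h^{i,m-i} *)
Local Notation C := R[i].
(* A filtration is indexed by nat, with F i = 0 for all i > m. *)
Local Notation filt := (nat -> {vspace V}).
Implicit Types (F : filt) (x : zform V) (f : 'End(V)).

Definition hdim (i : nat) : nat := (\sum_(i <= j < m.+1) hn j)%N.

Definition filtration : set filt := [set F |
  [/\ F 0%N = {:V}%VS, (forall i, (F i.+1 <= F i)%VS) &
      forall i, \dim (F i) = hdim i]].

Definition isotropic F (psi : V -> V -> C) : Prop :=
  forall i j, (m < i + j)%N ->
    forall u v, u \in F i -> v \in F j -> psi u v = 0.

Definition hodge x F (i : nat) : {vspace V} :=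
  (F i :&: conjv h x (F (m - i)%N))%VS.

Definition hodge_decomposition x F : Prop :=
  (\sum_(i < m.+1) hodge x F i)%VS = {:V}%VS /\
  directv (\sum_(i < m.+1) hodge x F i)%VS.

Definition hodge_positive x F : Prop :=
  forall (i : 'I_m.+1) (w : V), w \in hodge x F i -> w != 0 ->
    0 < (-1) ^+ ((m * m.-1)./2 + i) * 'i ^- m * psiC h x w (lconj h x w).

Definition push f F : filt := fun i => (f @: F i)%VS.

Definition lattice_coord (Psi : 'M[int]_h) (d : h.-tuple V) x : Prop :=
  [/\ polarized_lattice Psi x, zbasis x d &
      forall i j : 'I_h, form x d`_i d`_j = Psi i j].

Definition flag_coord (d : h.-tuple V) F : Prop :=
  basis_of {:V} d /\ forall i, F i = <<take (hdim i) d>>%VS.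

Definition Uset (Psi : 'M[int]_h) F0 (psi0 : V -> V -> C) : set (zform V) :=
  [set x | [/\ polarized_lattice Psi x,
               forall u v, psiC h x u v = psi0 u v,
               hodge_decomposition x F0 &
               hodge_positive x F0]].

Definition Dset x0 : set filt :=
  [set F | [/\ filtration F, isotropic F (psiC h x0),
               hodge_decomposition x0 F & hodge_positive x0 F]].

Definition G0 F0 (psi0 : V -> V -> C) : set 'End(V) :=
  [set f | (forall i, (f @: F0 i)%VS = F0 i) /\
           forall u v, psi0 (f u) (f v) = psi0 u v].

Definition G0_orbit F0 (psi0 : V -> V -> C) x : set (zform V) :=
  [set act x f | f in G0 F0 psi0].

Definition Gamma_orbit x0 F : set filt :=
  [set push (lext h x0 g) F | g in [set g | lattice_isom x0 x0 g]].

Definition U_mod_G0 (Psi : 'M[int]_h) F0 (psi0 : V -> V -> C) : cspace R :=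
  @quot_space R (coord_space (lattice_coord Psi) (Uset Psi F0 psi0))
    (G0_orbit F0 psi0).

Definition Gamma_mod_D x0 : cspace R :=
  @quot_space R (coord_space flag_coord (Dset x0)) (Gamma_orbit x0).

End Hodge.

(* Main.v *)
From HB Require Import structures.
Require Import Defs.
From mathcomp Require Import all_boot all_order all_algebra complex.
From mathcomp Require Import all_classical all_reals all_analysis.
From mathcomp Require Import ring zify.
Import passmx.
Import Order.TTheory GRing.Theory Num.Theory numFieldNormedType.Exports.
Set Implicit Arguments.
Unset Strict Implicit.
Unset Printing Implicit Defensive.
Local Open Scope classical_set_scope.
Local Open Scope ring_scope.

(** Write the lattices of type [Psi0] as pull-backs [act x0 G] of the fixed
    lattice [x0] by linear automorphisms [G] of [V0].  Call [G] a marking when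
    it carries the form [psi0] to the form of [x0] and the flag [F0] to a point
    of [D] ([marking]).  Since [G] is an isomorphism from [act x0 G] to [x0], it
    transports conjugation, forms and Hodge decompositions, so an invertible
    [G] is a marking exactly when [act x0 G] lies in [U] ([markingP]).  Two
    markings give the same lattice exactly when they differ on the left by an
    element of Gamma_Z, and the same flag exactly when they differ on the right
    by an element of [G0].  Both [U/G0] and [Gamma_Z\D] are therefore the double
    quotient of the set of markings by these two groups, and the bijection is
    induced by [G |-> (act x0 G, push G F0)] ([period_map_bij],
    [period_mapE]).

    This requires that every point of [D] is [push G F0] for a marking [G],
    which is a Witt theorem for flags ([isotropic_conj]).  For a flag with a
    Hodge decomposition, [F^a] is the whole orthogonal of [F^(m+1-a)]
    ([perp_fil]).  A linear map taking [F0] to the given flag pulls the form of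
    [x0] back to a form that differs from [psi0] by a self-adjoint automorphism
    [Y] preserving [F0].  Over the complex numbers [Y] has a square root that is
    a polynomial in [Y] ([mx_sqrt]); it is again self-adjoint, again preserves
    [F0], and corrects the linear map to an isometry.

    The two quotients carry the same topology and the same holomorphic functions
    as soon as the period map and its inverse lift locally to holomorphic maps
    between bases of [V0] ([quot_analytic_iso]).  From lattices to flags such a
    lift is explicit: if the rows of [N0] are a basis of [x0] and those of [E]
    are adapted to [F0], the lattice with basis [N] goes to the flag with adapted
    basis [E N^-1 N0] ([lattice_lift]).  In the other direction ([flag_lift]) fix
    a flag [F1] in [D] and a marking [G1] with [push G1 F0 = F1].  The Hodge
    decomposition of [F1] gives an opposite flag; for [F] near [F1] let [u] send
    a vector [v] of the summand [H^a] to the only vector of [F^a] that is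
    congruent to [v] modulo the sum of the [H^j] with [j < a].  Isotropy of [F]
    and of the opposite flag makes [u] an isometry ([unip_isom]), it takes [F1]
    to [F] ([unip_fil]), and its matrix is a rational function of a basis of [F].
    Then [u G1] is a marking that maps to [F]. *)

(** * Holomorphic functions of matrices *)

(** Holomorphy of determinants and inverses is reduced to that of entries,
    finite sums and finite products. *)
Section Calculus.
Variable K : numFieldType.

Lemma differentiable_near (U W : normedModType K) (f : U -> W) x (P : set W) :
  differentiable f x -> nbhs (f x) P -> \forall y \near x, P (f y).
Proof. by move=> /differentiable_continuous cf /cf. Qed.

Lemma nbhs_open_sub (U : normedModType K) (x : U) (P : set U) :
  nbhs x P -> exists B : set U, [/\ open B, B x & B `<=` P].
Proof. by rewrite nbhsE => -[B [oB Bx] BP]; exists B. Qed.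

Lemma differentiable_fsum (U W : normedModType K) (I : finType)
    (f : I -> U -> W) x : (forall i, differentiable (f i) x) ->
  differentiable (fun y => \sum_i f i y) x.
Proof.
move=> df; rewrite (_ : (fun y => _) = \sum_(i < #|I|) f (enum_val i)).
  by apply: differentiable_sum => i; exact: df.
apply/funext => y; rewrite fct_sumE.
by rewrite (reindex _ (onW_bij _ (@enum_val_bij I))).
Qed.

Lemma differentiable_fprod (U : normedModType K) (I : finType)
    (f : I -> U -> K^o) x : (forall i, differentiable (f i) x) ->
  differentiable (fun y => \prod_i f i y : K^o) x.
Proof.
move=> df; elim: (index_enum I) => [|i s IHs].
  under eq_fun do rewrite big_nil.
  exact: differentiable_cst.
under eq_fun do rewrite big_cons.
exact: (differentiableM (df i) IHs).
Qed.

Lemma differentiable_mx (U : normedModType K) m n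
    (f : U -> 'M[K]_(m, n)) x :
  (forall i j, differentiable (fun y => f y i j : K^o) x) -> differentiable f x.
Proof.
move=> df; rewrite (_ : f = fun y => \sum_i \sum_j f y i j *: delta_mx i j).
  do 2!apply: differentiable_fsum => ?; exact: differentiableZl.
by apply/funext => y; rewrite -matrix_sum_delta.
Qed.

Lemma differentiable_mx_id m n (x : 'M[K]_(m, n)) :
  differentiable (fun y : 'M[K]_(m, n) => y) x.
Proof. by apply: differentiable_mx => i j; exact: differentiable_coord. Qed.

Lemma differentiable_entry (U : normedModType K) m n
    (f : U -> 'M[K]_(m, n)) x i j :
  differentiable f x -> differentiable (fun y => f y i j : K^o) x.
Proof.
move=> df; apply: (@differentiable_comp _ _ _ _ f (fun N => N i j : K^o)) => //.
exact: differentiable_coord.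
Qed.

Lemma differentiable_mulmx (U : normedModType K) m n p
    (f : U -> 'M[K]_(m, n)) (g : U -> 'M[K]_(n, p)) x :
  differentiable f x -> differentiable g x ->
  differentiable (fun y => f y *m g y) x.
Proof.
move=> df dg; apply: differentiable_mx => i j.
under eq_fun do rewrite mxE.
apply: differentiable_fsum => k.
apply: differentiableM; exact: differentiable_entry.
Qed.

Lemma differentiable_det (U : normedModType K) n (f : U -> 'M[K]_n) x :
  differentiable f x -> differentiable (fun y => \det (f y) : K^o) x.
Proof.
move=> df; apply: differentiable_fsum => s; apply: differentiableM.
  exact: differentiable_cst.
apply: differentiable_fprod => i; exact: differentiable_entry.
Qed.

Lemma near_unitmx (U : normedModType K) n (f : U -> 'M[K]_n) x :
  differentiable f x -> f x \in unitmx -> \forall y \near x, f y \in unitmx.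
Proof.
move=> /differentiable_det/differentiable_continuous cf.
rewrite unitmxE unitfE => fx0.
have nz := @cvgr_neq0 K K^o U (nbhs x) _ (fun y => \det (f y)) _ cf fx0.
near=> y; rewrite unitmxE unitfE; near: y; exact: nz.
Unshelve. all: by end_near. Qed.

(** Agrees with the inverse on invertible matrices, and is given everywhere by
    one formula, so that its derivative can be computed by the usual rules. *)
Definition adjinv n (A : 'M[K]_n) := (\det A)^-1 *: \adj A.

Lemma adjinvE n (A : 'M[K]_n) : A \in unitmx -> adjinv A = invmx A.
Proof. by rewrite /adjinv /invmx => ->. Qed.

Lemma differentiable_adjinv (U : normedModType K) n (f : U -> 'M[K]_n) x :
  f x \in unitmx -> differentiable f x ->
  differentiable (fun y => adjinv (f y)) x.
Proof.
rewrite unitmxE unitfE => fx0 df; apply: differentiable_mx => i j.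
under eq_fun do rewrite !mxE.
apply: differentiableM.
  apply: differentiableV => //; exact: differentiable_det.
apply: differentiableM; first exact: differentiable_cst.
apply: differentiable_det; apply: differentiable_mx => k l.
under eq_fun do rewrite !mxE.
exact: differentiable_entry.
Qed.
End Calculus.

(** * Square roots of matrices *)

(** Hensel lifting one root at a time.  If [q] divides [p^2 - X] with quotient
    [r], then [(p + c q)^2 - X = (r + 2 c p + c^2 q) q], so the factor [X - a]
    can be added to [q] when [c] is a root of [r(a) + 2 p(a) c + q(a) c^2].
    This equation is solvable unless [p(a)] and [q(a)] both vanish, but then
    [a = p(a)^2 = 0]. *)
Lemma polynomial_sqrt_mod (F : closedFieldType) (s : seq F) :
  2%:R != 0 :> F -> 0 \notin s ->
  exists p : {poly F}, \prod_(a <- s) ('X - a%:P) %| p ^+ 2 - 'X.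
Proof.
move=> nz2; elim: s => [|a s IHs]; first by exists 0; rewrite big_nil dvd1p.
rewrite in_cons negb_or eq_sym => /andP[nza /IHs[p]].
set q := \prod_(a <- s) _ => /dvdpP[r pq].
have [c] : exists c, root (\poly_(i < 3) [:: r.[a]; 2%:R * p.[a]; q.[a]]`_i) c.
  apply/closed_rootP/negP => /size_poly1P[c _].
  move=> /polyP rc; have := rc 1%N; have := rc 2%N.
  rewrite !coef_poly !coefC/= => qa /eqP; rewrite mulf_eq0 (negPf nz2)/=.
  have /(congr1 (horner^~ a)) := pq; rewrite hornerM qa mulr0 hornerD hornerN horner_exp hornerX => /eqP.
  rewrite subr_eq0 => /eqP p2 /eqP pa.
  by move: p2; rewrite pa expr2 mulr0 => /esym/eqP; apply/negP.
move=> /rootP; rewrite horner_poly !big_ord_recl big_ord0/= => rc.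
exists (p + c *: q); rewrite big_cons -/q.
have -> : (p + c *: q) ^+ 2 - 'X = (r + 2%:R *: (c *: p) + c ^+ 2 *: q) * q.
  rewrite sqrrD addrAC -[X in X + _]addrAC pq -!mul_polyC.
  rewrite !polyCM; ring.
rewrite dvdp_mul ?dvdpp// dvdp_XsubCl; apply/rootP.
by rewrite -rc !hornerE/=; ring.
Qed.

(** The root [L] is a polynomial in [Y], by Cayley-Hamilton and
    [polynomial_sqrt_mod] for the eigenvalues of [Y].  Every condition that is
    linear and stable under powers passes from [Y] to [L]: being self-adjoint
    for [Q], and preserving a subspace. *)
Lemma mx_sqrt (F : closedFieldType) n (Y Q : 'M[F]_n) : 2%:R != 0 :> F ->
  Y \in unitmx -> Y *m Q = Q *m Y^T ->
  exists L, [/\ L *m L = Y, L *m Q = Q *m L^T &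
    forall m (W : 'M[F]_(m, n)), stablemx W Y -> stablemx W L].
Proof.
case: n Y Q => [|n] Y Q nz2.
  by exists Y; split=> //; rewrite [LHS]flatmx0 [RHS]flatmx0.
move=> uY YQ.
have [s char_s] := closed_field_poly_normal (char_poly Y).
rewrite (eqP (char_poly_monic Y)) scale1r in char_s.
have s0 : 0 \notin s.
  apply/negP => s0.
  have : root (char_poly Y) 0 by rewrite char_s root_prod_XsubC.
  rewrite -eigenvalue_root_char => /eigenvalueP[v]; rewrite scale0r => vY v0.
  by move: v0; rewrite -[v](mulmxK uY) vY mul0mx eqxx.
have [p] := polynomial_sqrt_mod nz2 s0.
rewrite -char_s => /dvdpP[r pr].
exists (horner_mx Y p); split.
- apply/eqP; rewrite -subr_eq0; apply/eqP.
  have := congr1 (horner_mx Y) pr.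
  by rewrite !rmorphB !rmorphM/= Cayley_Hamilton mulr0 horner_mx_X.
- elim/poly_ind: p {pr} => [|p c IHp]; first by rewrite rmorph0 mul0mx trmx0 mulmx0.
  rewrite rmorphD rmorphM/= horner_mx_X horner_mx_C linearD/= tr_scalar_mx.
  rewrite mulmxDl mulmxDr; congr (_ + _); last by rewrite scalar_mxC.
  rewrite -[LHS]mulmxA YQ mulmxA IHp -mulmxA -trmx_mul; congr (_ *m _^T).
  exact/comm_mx_horner/comm_mx_refl.
- move=> m W WY; elim/poly_ind: p {pr} => [|p c IHp].
    by rewrite rmorph0 stablemx0.
  rewrite rmorphD rmorphM/= horner_mx_X horner_mx_C.
  by rewrite stablemxD ?stablemxM ?stablemxC.
Qed.

(** * Lattices, their forms and conjugations *)

Section Lattices.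
Variables (R : realType) (V : vectType R[i]).
Local Notation C := R[i].
Local Notation n := (\dim {:V}).
Implicit Types (x y : zform V) (d : n.-tuple V) (G : 'End(V)) (u v w : V).

Lemma scalar_sum (f : V -> C) d v : basis_of {:V} d ->
  (forall a u v, f (a *: u + v) = a * f u + f v) ->
  f v = \sum_(i < n) coord d i v * f d`_i.
Proof.
move=> dB lf.
have f0 : f 0 = 0 by have := lf (-1) 0 0; rewrite scaler0 add0r mulN1r addNr.
rewrite {1}(coord_basis dB (memvf v)).
elim/big_ind2 : _ => // [_ u _ w <- <-|i _]; last first.
  by rewrite -[_ *: _]addr0 lf f0 addr0.
by rewrite -{1}[u]scale1r lf mul1r.
Qed.

Lemma gram_sum (B : V -> V -> C) d u v : basis_of {:V} d ->
  (forall v, scalar (B^~ v)) -> (forall u, scalar (B u)) ->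
  B u v = \sum_(i < n) \sum_(j < n) coord d i u * coord d j v * B d`_i d`_j.
Proof.
move=> dB Bl Br; rewrite (scalar_sum u dB (Bl v)).
apply: eq_bigr => i _; rewrite (scalar_sum v dB (Br _)) mulr_sumr.
by apply: eq_bigr => j _; rewrite mulrA.
Qed.

Lemma bilinear_eq (B B' : V -> V -> C) d : basis_of {:V} d ->
  (forall v, scalar (B^~ v)) -> (forall u, scalar (B u)) ->
  (forall v, scalar (B'^~ v)) -> (forall u, scalar (B' u)) ->
  (forall i j : 'I_n, B d`_i d`_j = B' d`_i d`_j) -> forall u v, B u v = B' u v.
Proof.
move=> dB Bl Br Bl' Br' e u v; rewrite (gram_sum u v dB Bl Br).
rewrite (gram_sum u v dB Bl' Br').
by apply: eq_bigr => i _; apply: eq_bigr => j _; rewrite e.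
Qed.

Lemma lat_mem x d (i : 'I_n) : zbasis x d -> lat x d`_i.
Proof.
move=> [_ ->]; exists (fun j => (j == i)%:Z).
rewrite (bigD1 i)//= eqxx big1 ?addr0// => j /negPf ->.
by rewrite mulr0z.
Qed.

Lemma latD x d u v : zbasis x d -> lat x u -> lat x v -> lat x (u + v).
Proof.
move=> [_ ->] [a ->] [b ->]; exists (fun i => a i + b i).
by rewrite -big_split/=; apply: eq_bigr => i _; rewrite mulrzDr.
Qed.

Lemma latN x d u : zbasis x d -> lat x u -> lat x (- u).
Proof.
move=> [_ ->] [a ->]; exists (fun i => - a i).
by rewrite -sumrN/=; apply: eq_bigr => i _; rewrite mulrNz.
Qed.

Lemma lat0 x d : zbasis x d -> lat x 0.
Proof.
move=> [_ ->]; exists (fun i => 0).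
by rewrite big1.
Qed.

(** An isomorphism of lattices and the two slots of the form of a lattice are
    only known to be additive on the lattice itself, so the usual lemmas on
    additive maps do not apply to them. *)
Lemma lat_additive_sum (W : zmodType) (f : V -> W) x d (a : 'I_n -> int) :
  zbasis x d ->
  (forall u v, lat x u -> lat x v -> f (u + v) = f u + f v) ->
  f (\sum_(i < n) d`_i *~ a i) = \sum_(i < n) f d`_i *~ a i.
Proof.
move=> dx fD.
have L0 := lat0 dx; have LD := latD dx; have LN := latN dx.
have f0 : f 0 = 0.
  by have := fD 0 0 L0 L0; rewrite addr0 => /(congr1 (+%R^~ (- f 0))); rewrite subrr addrK.
have fN u : lat x u -> f (- u) = - f u.
  move=> lu; have := fD _ _ (LN _ lu) lu; rewrite addNr f0 => /esym/eqP.
  by rewrite addr_eq0 => /eqP.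
have fM u k : lat x u -> lat x (u *+ k) /\ f (u *+ k) = f u *+ k.
  move=> lu; elim: k => [|k [lk fk]]; first by rewrite !mulr0n.
  by rewrite !mulrS fD// fk; split=> //; exact: LD.
have fZ u k : lat x u -> lat x (u *~ k) /\ f (u *~ k) = f u *~ k.
  move=> lu; case: k => k; rewrite /intmul; first exact: fM.
  by have [lk fk] := fM _ k.+1 lu; rewrite fN// fk; split=> //; exact: LN.
suff [] : lat x (\sum_(i < n) d`_i *~ a i) /\
          f (\sum_(i < n) d`_i *~ a i) = \sum_(i < n) f d`_i *~ a i by [].
elim/big_rec2 : _ => // i w u _ [lu <-].
have [lk fk] := fZ d`_i (a i) (lat_mem i dx).
by rewrite fD// fk; split=> //; exact: LD.
Qed.

Lemma coord_lat d (a : 'I_n -> int) i : basis_of {:V} d ->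
  coord d i (\sum_(j < n) d`_j *~ a j) = (a i)%:~R.
Proof.
move=> dB; rewrite (eq_bigr (fun j => (a j)%:~R *: d`_j)) => [|j _].
  by rewrite coord_sum_free// (basis_free dB).
by rewrite scaler_int.
Qed.

Lemma zb_zbasis x d : zbasis x d -> zbasis x (zb n x).
Proof. by move=> dx; apply: (@xgetPex _ _ [set d | zbasis x d]); exists d. Qed.

Lemma lextE x g v : lext n x g v = \sum_(i < n) coord (zb n x) i v *: g (zb n x)`_i.
Proof.
pose f v := \sum_(i < n) coord (zb n x) i v *: g (zb n x)`_i.
have lf : linear f.
  move=> a u w; rewrite /f scaler_sumr -big_split/=; apply: eq_bigr => i _.
  by rewrite linearP scalerDl scalerA.
pose F : {linear V -> V} := HB.pack f (GRing.isLinear.Build _ _ _ _ f lf).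
exact: (lfunE F).
Qed.

Lemma lext_lin x d G : zbasis x d -> lext n x G = G.
Proof.
move=> /zb_zbasis[zB _]; apply/lfunP => v; rewrite lextE.
rewrite {2}(coord_basis zB (memvf v)) linear_sum.
by apply: eq_bigr => i _; rewrite linearZ.
Qed.

Lemma lext_lat x d g v : zbasis x d ->
  (forall u v, lat x u -> lat x v -> g (u + v) = g u + g v) ->
  lat x v -> lext n x g v = g v.
Proof.
move=> /zb_zbasis zx gD; have [zB ->] := zx => -[a ->].
rewrite (lat_additive_sum a zx gD) lextE; apply: eq_bigr => i _.
by rewrite coord_lat// scaler_int.
Qed.

Lemma psiC_linl x v : scalar ((psiC n x)^~ v).
Proof.
move=> a u w; rewrite /psiC mulr_sumr -big_split/=; apply: eq_bigr => i _.
rewrite mulr_sumr -big_split/=; apply: eq_bigr => j _; rewrite linearP/=.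
by ring.
Qed.

Lemma psiC_linr x u : scalar (psiC n x u).
Proof.
move=> a v w; rewrite /psiC mulr_sumr -big_split/=; apply: eq_bigr => i _.
rewrite mulr_sumr -big_split/=; apply: eq_bigr => j _; rewrite linearP/=.
by ring.
Qed.

Lemma lconj_antilin x a u v :
  lconj n x (a *: u + v) = a^* *: lconj n x u + lconj n x v.
Proof.
rewrite /lconj scaler_sumr -big_split/=; apply: eq_bigr => i _.
by rewrite linearP/= rmorphD rmorphM scalerDl scalerA.
Qed.

Lemma lconj_sum x (I : finType) (c : I -> C) (e : I -> V) :
  lconj n x (\sum_i c i *: e i) = \sum_i (c i)^* *: lconj n x (e i).
Proof.
have l0 : lconj n x 0 = 0.
  by rewrite -[0 in LHS](scale0r 0) -[_ *: _]addr0 lconj_antilin rmorph0 scale0r add0r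
    /lconj big1// => i _; rewrite linear0 rmorph0 scale0r.
elim/big_rec2 : _ => // i _ u _ <-; exact: lconj_antilin.
Qed.

Lemma lconj_lat x d v : zbasis x d -> lat x v -> lconj n x v = v.
Proof.
move=> /zb_zbasis zx; have [zB ->] := zx => -[a ->].
by apply: eq_bigr => i _; rewrite coord_lat// rmorph_int scaler_int.
Qed.

Lemma lconjK x d v : zbasis x d -> lconj n x (lconj n x v) = v.
Proof.
move=> /zb_zbasis zx; have [zB _] := zx.
rewrite [X in lconj _ _ X]/lconj lconj_sum [RHS](coord_basis zB (memvf v)).
by apply: eq_bigr => i _; rewrite conjCK (lconj_lat zx)//; exact: lat_mem.
Qed.

Variable Psi : 'M[int]_n.
Notation polarized := (polarized_lattice Psi).

Lemma polarized_zb x : polarized x -> zbasis x (zb n x).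
Proof. by move=> [[d /zb_zbasis]]. Qed.

(** With [bilinear_eq] this characterizes [psiC] independently of the chosen
    basis [zb]. *)
Lemma psiC_lat x u v : polarized x -> lat x u -> lat x v ->
  psiC n x u v = (Defs.form x u v)%:~R.
Proof.
move=> px; have zx := polarized_zb px; case: px => _ fl fr _.
have [zB ->] := zx => -[a ->] [b ->].
rewrite (lat_additive_sum (f := (Defs.form x)^~ _) a zx); last first.
  move=> *; apply: fl => //; rewrite zx.2; by exists b.
rewrite rmorph_sum; apply: eq_bigr => i _.
rewrite (lat_additive_sum b zx); last by move=> *; apply: fr => //; exact: lat_mem.
rewrite mulrzz rmorphM rmorph_sum mulr_suml; apply: eq_bigr => j _.
rewrite mulrzz rmorphM/= !coord_lat//; ring.
Qed.

End Lattices.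

(** * Pulling lattices back by automorphisms *)

Section Act.
Variables (R : realType) (V : vectType R[i]).
Local Notation C := R[i].
Local Notation n := (\dim {:V}).
Implicit Types (x y : zform V) (d e : n.-tuple V) (G : 'End(V)) (u v w : V).

Lemma zform_eq x y : (forall v, lat x v <-> lat y v) ->
  (forall u v, Defs.form x u v = Defs.form y u v) -> x = y.
Proof.
case: x y => [L B] [L' B'] /= eL eB; congr ZForm.
  by apply/funext => v; apply/propext.
by apply/funext => u; apply/funext => v.
Qed.

Lemma limgf_lker0 G : limg G = {:V}%VS -> lker G == 0%VS.
Proof.
move=> Gs; have := limg_ker_dim G {:V}%VS.
rewrite capfv Gs -[RHS]add0n => /eqP; rewrite eqn_add2r.
by rewrite dimv_eq0.
Qed.

Lemma basis_lker0 d e G : basis_of {:V} d -> basis_of {:V} e ->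
  (forall i : 'I_n, G d`_i = e`_i) -> lker G == 0%VS.
Proof.
move=> dB eB Gde; apply: limgf_lker0; apply/eqP; rewrite eqEsubv subvf/=.
rewrite -[X in (X <= _)%VS](span_basis eB); apply/span_subvP => v /tnthP[i ->].
by rewrite (tnth_nth 0) -Gde memv_img ?memvf.
Qed.

Lemma lker0_basis d G : lker G == 0%VS -> basis_of {:V} d ->
  basis_of {:V} (map_tuple G d).
Proof.
move=> G0 dB; have := limg_basis_of (f := G) _ dB; rewrite (lker0_limgf G0); apply.
by rewrite (eqP G0) capv0.
Qed.

Lemma lker0_inv G : lker G == 0%VS -> lker (G^-1)%VF == 0%VS.
Proof. by move=> G0; apply/lker0P/(can_inj (lker0_lfunVK G0)). Qed.

Lemma lker0_comp G (H : 'End(V)) : lker G == 0%VS -> lker H == 0%VS -> lker (G \o H)%VF == 0%VS.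
Proof.
move=> /lker0P Gi /lker0P Hi; apply/lker0P => u v.
by rewrite !comp_lfunE => /Gi/Hi.
Qed.

Lemma actM y G (H : 'End(V)) : act (act y G) H = act y (G \o H)%VF.
Proof. by apply: zform_eq => *; rewrite /act/= ?comp_lfunE. Qed.

Lemma act1 y : act y \1%VF = y.
Proof. by apply: zform_eq => *; rewrite /act/= ?id_lfunE. Qed.

Lemma act_zbasis y d G : lker G == 0%VS -> zbasis y d ->
  zbasis (act y G) (map_tuple (G^-1)%VF d).
Proof.
move=> G0 [dB Ly]; split.
  exact: (lker0_basis (lker0_inv G0) dB).
apply/funext => v; apply/propext; rewrite -[lat (act _ _) v]/(lat y (G v)) Ly; split=> -[a va]; exists a.
  rewrite -[v](lker0_lfunK G0) va linear_sum; apply: eq_bigr => i _.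
  by rewrite raddfMz (nth_map 0) ?size_tuple.
rewrite va linear_sum; apply: eq_bigr => i _.
by rewrite raddfMz (nth_map 0) ?size_tuple//; congr (_ *~ _); exact: lker0_lfunVK.
Qed.

Variable Psi : 'M[int]_n.
Notation polarized := (polarized_lattice Psi).

Lemma polarized_act y G : lker G == 0%VS -> polarized y -> polarized (act y G).
Proof.
move=> G0 [[d dy dPsi] fl fr f0]; split => [||| u v nl]; last exact: f0.
- exists (map_tuple (G^-1)%VF d); first exact: act_zbasis.
  by move=> i j; rewrite /act/= !(nth_map 0) ?size_tuple//= !lker0_lfunVK.
- by move=> u v w lu lv lw; rewrite /= linearD; apply: fl.
- by move=> u v w lu lv lw; rewrite /= linearD; apply: fr.
Qed.

Lemma psiC_act y G u v : lker G == 0%VS -> polarized y ->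
  psiC n (act y G) u v = psiC n y (G u) (G v).
Proof.
move=> G0 py; have px := polarized_act G0 py.
have zx := polarized_zb px; have [zB _] := zx.
apply: (bilinear_eq (B' := fun u v => psiC n y (G u) (G v)) zB).
- exact: psiC_linl.
- exact: psiC_linr.
- by move=> w a u' v'; rewrite linearP; apply: psiC_linl.
- by move=> w a u' v'; rewrite linearP; apply: psiC_linr.
move=> i j; have li := lat_mem i zx; have lj := lat_mem j zx.
by rewrite (psiC_lat px)// (psiC_lat py).
Qed.

Lemma lconj_act y G v : lker G == 0%VS -> polarized y ->
  G (lconj n (act y G) v) = lconj n y (G v).
Proof.
move=> G0 py; have px := polarized_act G0 py.
have zx := polarized_zb px; have [zB _] := zx.
rewrite [in RHS](coord_basis zB (memvf v)) [X in _ = lconj _ _ X]linear_sum/=.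
rewrite [in LHS]/lconj linear_sum/= .
under [X in _ = lconj _ _ X]eq_bigr do rewrite linearZ/=.
rewrite lconj_sum; apply: eq_bigr => i _; rewrite linearZ/=.
by rewrite (lconj_lat (polarized_zb py))//; exact: (lat_mem i zx).
Qed.

Lemma lattice_isom_act y G : lker G == 0%VS -> lattice_isom (act y G) y G.
Proof.
move=> G0; split=> //; last by move=> *; rewrite linearD.
split=> //; first by move=> u v _ _; apply/lker0P.
by move=> v lv; exists ((G^-1)%VF v); rewrite /act/= ?lker0_lfunVK.
Qed.

(** The values of [form] outside of the lattice are 0 by convention, so that an
    isomorphism determines its source as a pull-back of its target. *)
Lemma lattice_isom_lext x y g : polarized x -> polarized y ->
  lattice_isom x y g ->
  lker (lext n x g) == 0%VS /\ x = act y (lext n x g).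
Proof.
move=> px py [[gxy gi gs] gD gf].
have zx := polarized_zb px; have zy := polarized_zb py.
have eg v : lat x v -> lext n x g v = g v by move=> lv; exact: (lext_lat zx).
have G0 : lker (lext n x g) == 0%VS.
  apply: limgf_lker0; apply/eqP; rewrite eqEsubv subvf/=.
  have [zB _] := zy; rewrite -[X in (X <= _)%VS](span_basis zB); apply/span_subvP => v /tnthP[i ->].
  rewrite (tnth_nth 0); have [u lu <-] := gs _ (lat_mem i zy).
  by rewrite -eg// memv_img ?memvf.
have lE v : lat x v <-> lat y (lext n x g v).
  split=> [lv|/gs[u lu]]; first by rewrite eg//; apply: gxy.
  by rewrite -eg// => /(lker0P G0) <-.
split=> //; apply: zform_eq => // u v; rewrite /act/=.
have [[lu lv]|nl] := pselect (lat x u /\ lat x v); first by rewrite !eg// gf.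
have [_ _ _ ->//] := px; have [_ _ _ ->//] := py.
by move=> [/lE lu /lE lv]; apply: nl.
Qed.

Lemma lattice_coord_act d e x y G : lattice_coord Psi d x ->
  lattice_coord Psi e y -> (forall i : 'I_n, G d`_i = e`_i) ->
  lker G == 0%VS /\ x = act y G.
Proof.
move=> [px zx fx] [py zy fy] Gde.
have [dB Lx] := zx; have [eB Ly] := zy.
have G0 := basis_lker0 dB eB Gde; split=> //.
have GL a : G (\sum_(i < n) d`_i *~ a i) = \sum_(i < n) e`_i *~ a i.
  by rewrite linear_sum; apply: eq_bigr => i _; rewrite raddfMz/= Gde.
have lE v : lat x v <-> lat y (G v).
  rewrite Lx Ly; split=> -[a va]; exists a; first by rewrite va GL.
  by apply: (lker0P G0); rewrite va GL.
apply: zform_eq => // u v; rewrite /act/=.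
have [[lu lv]|nl] := pselect (lat x u /\ lat x v); last first.
  have [_ _ _ ->//] := px; have [_ _ _ ->//] := py.
  by move=> [/lE lu /lE lv]; apply: nl.
apply: (@intr_inj C); rewrite -(psiC_lat px)// -(psiC_lat py) -?lE//.
rewrite -(psiC_act _ _ G0 py); have px' := polarized_act G0 py.
apply: (bilinear_eq dB); try exact: psiC_linl; try exact: psiC_linr.
move=> i j; have li := lat_mem i zx; have lj := lat_mem j zx.
rewrite (psiC_lat px)// (psiC_lat px') -?[lat (act _ _) _]/(lat y (G _)) -?lE//.
by rewrite -[Defs.form (act _ _) _ _]/(Defs.form y (G _) (G _)) !Gde fx fy.
Qed.

End Act.

(** * Forms of a given type *)

Section Forms.
Variables (R : realType) (V : vectType R[i]).
Local Notation C := R[i].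
Local Notation n := (\dim {:V}).
Local Notation b := (vbasis {:V}).
Implicit Types (x y : zform V) (d e : n.-tuple V) (G : 'End(V)) (u v w : V).
Variables (m : nat) (Psi : 'M[int]_n).
Hypothesis Psi_sym : forall a b : 'cV[int]_n,
    intform Psi a b = (-1) ^+ m * intform Psi b a.
Hypothesis Psi_nondeg : int_nondegenerate Psi.
Notation polarized := (polarized_lattice Psi).

Lemma intform_delta (i j : 'I_n) :
  intform Psi (delta_mx i 0) (delta_mx j 0) = Psi i j.
Proof. by rewrite /intform trmx_delta -rowE -colE !mxE. Qed.

Lemma Psi_symE (i j : 'I_n) : Psi i j = (-1) ^+ m * Psi j i.
Proof. by rewrite -!intform_delta. Qed.

(** Shared by [psi0] and by the forms of all lattices of type [Psi];
    nondegeneracy and symmetry follow from the matrix in one basis. *)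
Definition typed_form (B : V -> V -> C) :=
  [/\ forall v, scalar (B^~ v), forall u, scalar (B u) &
    exists2 d : n.-tuple V, basis_of {:V} d &
      forall i j : 'I_n, B d`_i d`_j = (Psi i j)%:~R].

Lemma typed_form_sym B u v : typed_form B -> B u v = (-1) ^+ m * B v u.
Proof.
move=> [Bl Br [d dB Bd]].
rewrite (gram_sum u v dB Bl Br) (gram_sum v u dB Bl Br) exchange_big/=.
rewrite mulr_sumr; apply: eq_bigr => j _.
rewrite mulr_sumr; apply: eq_bigr => i _.
rewrite !Bd Psi_symE rmorphM rmorphXn rmorphN rmorph1/=; ring.
Qed.

(** The rows of the inverse represent the coordinate functionals. *)
Lemma Psi_linv : exists A : 'M[int]_n, A *m Psi = 1%:M.
Proof.
have /boolp.choice[A AP] : forall k : 'I_n, exists a : 'cV[int]_n,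
    forall c : 'cV[int]_n, c k 0 = intform Psi a c.
  move=> k; pose phi (c : 'cV[int]_n) := c k 0.
  have phiB : {morph phi : x y / x - y} by move=> x y; rewrite /phi !mxE.
  pose F : {additive 'cV[int]_n -> int} :=
    HB.pack phi (GRing.isZmodMorphism.Build _ _ phi phiB).
  by have [a [aP _]] := Psi_nondeg F; exists a => c; rewrite -aP.
exists (\matrix_k (A k)^T); apply/row_matrixP => k.
rewrite row_mul rowK; apply/rowP => l.
have := AP k (delta_mx l 0); rewrite /intform -colE.
by rewrite !mxE !eqxx andbT => ->.
Qed.

Lemma typed_form_nondeg B u : typed_form B -> (forall v, B u v = 0) -> u = 0.
Proof.
move=> [Bl Br [d dB Bd]] Bu.
have [A AP] := Psi_linv.
have PA : Psi *m A = 1%:M by apply: mulmx1C.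
pose f : int -> C := intmul 1; pose r := \row_i coord d i u.
have rPsi : r *m map_mx f Psi = 0.
  apply/rowP => j; rewrite !mxE -[RHS](Bu d`_j) (scalar_sum u dB (Bl _)).
  by apply: eq_bigr => i _; rewrite Bd !mxE.
have r0 : r = 0.
  rewrite -[r]mulmx1 -(map_mx1 f) -PA map_mxM.
  by rewrite mulmxA rPsi mul0mx.
rewrite (coord_basis dB (memvf u)); apply: big1 => k _.
by have /rowP/(_ k) := r0; rewrite !mxE => ->; rewrite scale0r.
Qed.

Lemma psiC_typed x : polarized x -> typed_form (psiC n x).
Proof.
move=> px; split; [exact: psiC_linl | exact: psiC_linr|].
have [[d zd dP] _ _ _] := px; exists d => [|i j]; first by case: zd.
by rewrite (psiC_lat px) ?dP//; exact: lat_mem.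
Qed.

(** [lconj x] is an antilinear involution. *)
Lemma mem_conjv x U w : polarized x ->
  (w \in conjv n x U) = (lconj n x w \in U).
Proof.
move=> px; have zx := polarized_zb px.
rewrite /conjv; set X := map _ _.
have sX : size X = \dim U by rewrite size_map size_tuple.
pose t : (\dim U).-tuple V := map_tuple (lconj n x) (vbasis U).
have tE (i : 'I_(\dim U)) : t`_i = lconj n x (vbasis U)`_i.
  by rewrite (nth_map 0) ?size_tuple.
apply/idP/idP => [|wU].
  move=> /(coord_span (X := t)) ->; rewrite lconj_sum.
  apply: memv_suml => i _; apply: memvZ; rewrite tE (lconjK _ zx).
  by apply: vbasis_mem; rewrite mem_nth ?size_tuple.
rewrite -[w](lconjK _ zx) (coord_vbasis wU) lconj_sum.
apply: memv_suml => i _; apply: memvZ.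
by rewrite memv_span// -tE mem_nth ?size_tuple.
Qed.

(** The form is integral, hence real, on the lattice. *)
Lemma psiC_conj x u v : polarized x ->
  psiC n x (lconj n x u) (lconj n x v) = (psiC n x u v)^*.
Proof.
move=> px; have [zB _] := polarized_zb px.
rewrite /psiC rmorph_sum; apply: eq_bigr => i _.
rewrite rmorph_sum; apply: eq_bigr => j _.
rewrite !coord_sum_free ?(basis_free zB)// !rmorphM/=.
by rewrite rmorph_int.
Qed.

End Forms.

(** * Isotropic flags with a Hodge decomposition *)

Section HodgeT.
Variables (R : realType) (V : vectType R[i]).
Local Notation C := R[i].
Local Notation n := (\dim {:V}).
Implicit Types (x y : zform V) (d e : n.-tuple V) (G : 'End(V)) (u v w : V).
Variables (m : nat) (Psi : 'M[int]_n).
Notation polarized := (polarized_lattice Psi).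
Implicit Types (F : nat -> {vspace V}).

Lemma memv_limg_inj G U v : lker G == 0%VS -> (G v \in (G @: U)%VS) = (v \in U).
Proof.
move=> G0; apply/idP/idP => [/memv_imgP[u uU /(lker0P G0) ->]//|]; exact: memv_img.
Qed.

Lemma memv_hodge x F i w : polarized x ->
  (w \in hodge n m x F i) = (w \in F i) && (lconj n x w \in F (m - i)%N).
Proof. by move=> px; rewrite memv_cap (mem_conjv _ _ px). Qed.

Lemma mem_hodge_act y G F i w : lker G == 0%VS -> polarized y ->
  (G w \in hodge n m y (push G F) i) = (w \in hodge n m (act y G) F i).
Proof.
move=> G0 py; have px := polarized_act G0 py.
by rewrite (memv_hodge _ _ _ px) (memv_hodge _ _ _ py) -(lconj_act _ G0 py) !memv_limg_inj.
Qed.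

Lemma hodge_push y G F i : lker G == 0%VS -> polarized y ->
  hodge n m y (push G F) i = (G @: hodge n m (act y G) F i)%VS.
Proof.
move=> G0 py; apply/vspaceP => w.
by rewrite -[w](lker0_lfunVK G0) mem_hodge_act// memv_limg_inj.
Qed.

Lemma hodge_decomposition_act y G F : lker G == 0%VS -> polarized y ->
  hodge_decomposition n m y (push G F) <-> hodge_decomposition n m (act y G) F.
Proof.
move=> G0 py; rewrite /hodge_decomposition !directvE/=.
under eq_bigr do rewrite hodge_push//.
under [X in _ == X]eq_bigr do rewrite hodge_push// limg_dim_eq ?(eqP G0) ?capv0//.
rewrite -limg_sum limg_dim_eq ?(eqP G0) ?capv0//.
have LG := lker0_limgf G0.
split=> -[e ->]; split=> //; first by apply/eqP; rewrite -(eq_limg_ker0 _ _ G0) e LG.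
by rewrite e LG.
Qed.

Lemma hodge_positive_act y G F : lker G == 0%VS -> polarized y ->
  hodge_positive n m y (push G F) <-> hodge_positive n m (act y G) F.
Proof.
move=> G0 py; split=> P i w.
  rewrite -(mem_hodge_act _ _ _ G0 py) => wH w0.
  rewrite (psiC_act _ _ G0 py) (lconj_act _ G0 py); apply: P => //.
  by rewrite -(linear0 G) (inj_eq (lker0P G0)).
rewrite -[w](lker0_lfunVK G0); set w' := _ w.
rewrite (mem_hodge_act _ _ _ G0 py) => wH w0.
rewrite -(lconj_act _ G0 py) -(psiC_act _ _ G0 py); apply: P => //.
by apply: contra w0 => /eqP->; rewrite linear0.
Qed.

Hypothesis Psi_nondeg : int_nondegenerate Psi.

Lemma decreasing_sub F i j : (forall i, (F i.+1 <= F i)%VS) -> (i <= j)%N ->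
  (F j <= F i)%VS.
Proof.
move=> dF /subnK <-; elim: (j - i)%N => [|k IHk]; first by rewrite add0n.
by rewrite addSn; apply: subv_trans (dF _) IHk.
Qed.

Section Projections.
Variables (x : zform V) (F : nat -> {vspace V}).
Hypothesis px : polarized x.
Hypothesis dF : forall i, (F i.+1 <= F i)%VS.
Hypothesis iF : isotropic m F (psiC n x).
Hypothesis sF : (\sum_(i < m.+1) hodge n m x F i)%VS = {:V}%VS.

Let psi := psiC n x.

Lemma psiC0r u : psi u 0 = 0.
Proof. by have := psiC_linr x u (-1) 0 0; rewrite scaler0 add0r mulN1r addNr. Qed.
Lemma psiC0l u : psi 0 u = 0.
Proof. by have := psiC_linl x u (-1) 0 0; rewrite scaler0 add0r mulN1r addNr. Qed.
Lemma psiCDr u v w : psi u (v + w) = psi u v + psi u w.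
Proof. by rewrite /psi -{1}[v]scale1r psiC_linr mul1r. Qed.
Lemma psiCDl u v w : psi (v + w) u = psi v u + psi w u.
Proof. by rewrite /psi -{1}[v]scale1r psiC_linl mul1r. Qed.

Lemma psiCBl u v w : psi (v - w) u = psi v u - psi w u.
Proof. by apply/eqP; rewrite eq_sym subr_eq -psiCDl subrK. Qed.

Lemma psiC_sumr u I (r : seq I) P (f : I -> V) :
  psi u (\sum_(i <- r | P i) f i) = \sum_(i <- r | P i) psi u (f i).
Proof. by apply: big_morph; [exact: psiCDr | exact: psiC0r]. Qed.
Lemma psiC_suml u I (r : seq I) P (f : I -> V) :
  psi (\sum_(i <- r | P i) f i) u = \sum_(i <- r | P i) psi (f i) u.
Proof. by apply: (big_morph (psi^~ u)); [exact: psiCDl | exact: psiC0l]. Qed.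

(** [H^i] lies in the conjugate of [F^(m-i)], and the conjugate flag is
    isotropic because the form is real. *)
Lemma hodge_orth i j u v : (i + j < m)%N ->
  u \in hodge n m x F i -> v \in hodge n m x F j -> psi u v = 0.
Proof.
move=> ij; rewrite !(memv_hodge _ _ _ px) => /andP[_ cu] /andP[_ cv].
have mij : (m < (m - i) + (m - j))%N by lia.
have /(congr1 (fun z => z^*)) := iF mij cu cv.
by rewrite (psiC_conj _ _ px) conjCK rmorph0.
Qed.

Definition hproj (i : 'I_m.+1) : 'End(V) := sumv_pi_for (esym sF) i.

Lemma hprojP i v : hproj i v \in hodge n m x F i.
Proof. exact: memv_sum_pi. Qed.

Lemma hproj_sum v : \sum_i hproj i v = v.
Proof. by apply: (sumv_pi_sum (esym sF)); apply: memvf. Qed.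

Lemma hproj_fil i v : hproj i v \in F i.
Proof. by have := hprojP i v; rewrite (memv_hodge _ _ _ px) => /andP[]. Qed.

(** The projection to [F^a] along the sum of the [H^j] with [j < a]. *)
Definition fproj (a : nat) : 'End(V) := \sum_(i < m.+1 | (a <= i)%N) hproj i.

Lemma fproj_fil a v : fproj a v \in F a.
Proof.
rewrite sum_lfunE; apply: memv_suml => i ai.
exact: subvP (decreasing_sub dF ai) _ (hproj_fil i v).
Qed.

Lemma fprojC a v : v - fproj a v = \sum_(i < m.+1 | (i < a)%N) hproj i v.
Proof.
rewrite -{1}[v]hproj_sum (bigID (fun i : 'I__ => (a <= i)%N))/= sum_lfunE.
by rewrite [X in X - _]addrC addrK; apply: eq_bigl => i; rewrite ltnNge.
Qed.

(** The remainder [v - fproj a v] lies in the sum of the [H^j] with [j < a].  It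
    is orthogonal to [H^k] for [k <= m - a] by [hodge_orth], and for
    [k >= m + 1 - a] because both [v] and [fproj a v] are.  So it is orthogonal
    to everything. *)
Lemma perp_fproj a v : (forall u, u \in F (m.+1 - a)%N -> psi v u = 0) ->
  fproj a v = v.
Proof.
move=> va; apply/eqP; rewrite eq_sym -subr_eq0; apply/eqP.
apply: (typed_form_nondeg Psi_nondeg (psiC_typed px)) => u.
rewrite -[u]hproj_sum -/psi psiC_sumr; apply: big1 => k _.
have [ka|ka] := leqP (m.+1 - a) k; last first.
  rewrite fprojC psiC_suml; apply: big1 => j ja.
  by apply: (hodge_orth _ (hprojP j v) (hprojP k u)); lia.
rewrite psiCBl va ?sub0r; last exact: subvP (decreasing_sub dF ka) _ (hproj_fil k u).
rewrite sum_lfunE psiC_suml big1 ?oppr0// => j aj.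
by apply: iF (hproj_fil j v) (hproj_fil k u); lia.
Qed.

Lemma fproj_id a v : v \in F a -> fproj a v = v.
Proof.
move=> vF; apply: perp_fproj => u uF; apply: iF vF uF; lia.
Qed.

Lemma perp_fil a v : (forall u, u \in F (m.+1 - a)%N -> psi v u = 0) -> v \in F a.
Proof. by move/perp_fproj <-; exact: fproj_fil. Qed.

(** [hproj i] is the difference of two consecutive [fproj], and both fix [v]. *)
Lemma hproj_lt (a : nat) (i : 'I_m.+1) v : v \in F a -> (i < a)%N -> hproj i v = 0.
Proof.
move=> vF ia; have := fproj_id (subvP (decreasing_sub dF ia) _ vF).
have := fproj_id (subvP (decreasing_sub dF (ltnW ia)) _ vF).
rewrite !sum_lfunE (bigD1 i)//= => e1 e2.
move: e1; rewrite (eq_bigl (fun j : 'I__ => (i < j)%N)) => [|j]; last first.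
  by rewrite ltn_neqAle andbC; congr (_ && _); rewrite eq_sym.
by rewrite e2 => /eqP; rewrite -subr_eq0 addrK => /eqP.
Qed.

(** Comparison of [F] with a nearby isotropic flag [F'].  Here [T] is a linear
    map with [T F^a] inside [F'^a], and [W a] is a right inverse of the operator
    [fproj a T fproj a + (1 - fproj a)], which exists when [T] is close to the
    identity. *)
Section Unipotent.
Variables (T : 'End(V)) (W : 'I_m.+1 -> 'End(V)) (F' : nat -> {vspace V}).
Hypothesis TF : forall a, (T @: F a <= F' a)%VS.
Hypothesis dF' : forall i, (F' i.+1 <= F' i)%VS.
Hypothesis iF' : isotropic m F' psi.
Hypothesis WP : forall (a : 'I_m.+1) v,
  fproj a (T (fproj a (W a v))) + (W a v - fproj a (W a v)) = v.

(** On [H^a] this is the map [v |-> T w], where [w] is the vector of [F^a] with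
    [fproj a (T w) = v]. *)
Definition unip : 'End(V) := \sum_(a < m.+1) (T \o W a \o hproj a)%VF.

Lemma unipE v : unip v = \sum_(a < m.+1) T (W a (hproj a v)).
Proof. by rewrite sum_lfunE; apply: eq_bigr => a _; rewrite !comp_lfunE. Qed.

(** Apply [1 - fproj a] to the equation that defines [W a]. *)
Lemma W_fproj (a : 'I_m.+1) v : fproj a (W a (hproj a v)) = W a (hproj a v).
Proof.
have e := WP a (hproj a v); set w := W a _ in e *.
apply/eqP; rewrite eq_sym -subr_eq0; apply/eqP.
have : fproj a (w - fproj a w) = w - fproj a w.
  apply: fproj_id; rewrite -(addKr (fproj a (T (fproj a w))) (w - _)) e.
  by rewrite addrC memvB ?hproj_fil ?fproj_fil.
by rewrite linearB/= (fproj_id (fproj_fil a w)) subrr => <-.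
Qed.

Lemma TW_fil (a : 'I_m.+1) v : T (W a (hproj a v)) \in F' a.
Proof.
by apply: (subvP (TF a)); rewrite memv_img// -W_fproj fproj_fil.
Qed.

Lemma TW_low (a : 'I_m.+1) v : T (W a (hproj a v)) =
  hproj a v + \sum_(i < m.+1 | (i < a)%N) hproj i (T (W a (hproj a v))).
Proof.
have := WP a (hproj a v); rewrite !W_fproj subrr addr0 => e.
by rewrite -fprojC e addrC subrK.
Qed.

(** Compare the two sides on [H^i] and [H^j].  If [i + j > m], both vanish since
    [F] and [F'] are isotropic.  Otherwise [unip] changes the arguments by
    vectors of lower Hodge summands, whose contributions vanish by
    [hodge_orth]. *)
Lemma unip_isom u v : psi (unip u) (unip v) = psi u v.
Proof.
rewrite !unipE -{2}[u]hproj_sum -{2}[v]hproj_sum !psiC_suml.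
apply: eq_bigr => i _; rewrite !psiC_sumr; apply: eq_bigr => j _.
have [ij|ij] := ltnP m (i + j).
  rewrite (iF' ij (TW_fil i u) (TW_fil j v)).
  exact/esym/(iF ij (hproj_fil i u) (hproj_fil j v)).
rewrite (TW_low i u) (TW_low j v) psiCDl !psiCDr.
rewrite [X in _ + X + _]psiC_sumr big1 => [|k kj]; last first.
  by apply: (hodge_orth _ (hprojP _ _) (hprojP _ _)); lia.
rewrite [X in _ + (X + _)]psiC_suml big1 => [|k ki]; last first.
  by apply: (hodge_orth _ (hprojP _ _) (hprojP _ _)); lia.
rewrite [X in _ + (_ + X)]psiC_suml big1 ?addr0// => k ki.
rewrite psiC_sumr big1// => l lj.
by apply: (hodge_orth _ (hprojP _ _) (hprojP _ _)); lia.
Qed.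

Lemma unip_fil a : (unip @: F a <= F' a)%VS.
Proof.
apply/subvP => _ /memv_imgP[v vF ->]; rewrite unipE; apply: memv_suml => i _.
have [ai|ia] := leqP a i; first exact: subvP (decreasing_sub dF' ai) _ (TW_fil _ _).
by rewrite (hproj_lt vF ia) !linear0 mem0v.
Qed.

End Unipotent.
End Projections.
End HodgeT.

(** * Frames, flags and a Witt theorem *)

Section Frames.
Variables (R : realType) (V : vectType R[i]).
Local Notation C := R[i].
Local Notation n := (\dim {:V}).
Local Notation b := (vbasis {:V}).
Implicit Types (d e : n.-tuple V) (G : 'End(V)) (u v w : V) (M N : 'M[C]_n).

Lemma vbasis_full : basis_of {:V} b. Proof. exact: vbasisP. Qed.

(** Coordinates are row vectors, so [lin] reverses products. *)
Definition lin M : 'End(V) := hommx b b M.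

Lemma linM M N : lin (M *m N) = (lin N \o lin M)%VF.
Proof. exact: (hommx_mul vbasis_full vbasis_full vbasis_full). Qed.

Lemma lin1 : lin 1%:M = \1%VF.
Proof. exact: (hommx1 vbasis_full). Qed.

Lemma lin_lker0 M : M \in unitmx -> lker (lin M) == 0%VS.
Proof.
move=> uM; apply/lker0P/(@can_inj _ _ _ (lin (invmx M))) => v.
by rewrite -comp_lfunE -linM mulmxV// lin1 id_lfunE.
Qed.

Lemma lker0_unitmx G : lker G == 0%VS -> mxof b b G \in unitmx.
Proof.
move=> G0; have : mxof b b G *m mxof b b (G^-1)%VF = 1%:M.
  by rewrite -mxof_comp ?vbasis_full// lker0_compVf// (mxof1 (basis_free vbasis_full)).
by move=> /mulmx1_unit[].
Qed.

Lemma linD M N : lin (M + N) = lin M + lin N.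
Proof. exact: linearD. Qed.

Lemma linB M N : lin (M - N) = lin M - lin N.
Proof. exact: linearB. Qed.

Lemma lin_sum (I : finType) (M : I -> 'M[C]_n) :
  lin (\sum_i M i) = \sum_i lin (M i).
Proof. exact: linear_sum. Qed.

Lemma lin_inv M : M \in unitmx -> lin (invmx M) = (lin M)^-1%VF.
Proof.
move=> uM; have M0 := lin_lker0 uM; apply/lfunP => v; apply: (lker0P M0).
by rewrite -comp_lfunE -linM mulVmx// lin1 id_lfunE lker0_lfunVK.
Qed.

Lemma lin_mxof G : lin (mxof b b G) = G.
Proof. by rewrite /lin mxofK ?vbasis_full. Qed.

Lemma frameE M (i : 'I_n) : (frame M)`_i = lin M b`_i.
Proof.
by rewrite -tnth_nth tnth_mktuple /lin hommxE ?vbasis_full// (rVofE vbasis_full) -rowE /vecof;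
  apply: eq_bigr => j _; rewrite mxE.
Qed.

Lemma frame_lin M N (i : 'I_n) : (frame (M *m N))`_i = lin N (frame M)`_i.
Proof. by rewrite !frameE linM comp_lfunE. Qed.

Lemma frame_surj d : exists M, frame M = d.
Proof.
exists (\matrix_(i, j) coord b j d`_i); apply: eq_from_tnth => i.
rewrite tnth_mktuple (tnth_nth 0) [RHS](coord_basis vbasis_full (memvf _)).
by apply: eq_bigr => j _; rewrite mxE.
Qed.

Lemma frame_map M N : frame (M *m N) = map_tuple (lin N) (frame M).
Proof.
apply: eq_from_tnth => i; by rewrite [RHS]tnth_map !(tnth_nth 0) frame_lin.
Qed.

Lemma frame1 : frame 1%:M = b.
Proof.
by apply: eq_from_tnth => i; rewrite !(tnth_nth 0) frameE lin1 id_lfunE.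
Qed.

Lemma frame_basis M : basis_of {:V} (frame M) = (M \in unitmx).
Proof.
apply/idP/idP => [MB|uM]; last first.
  by rewrite -[M]mul1mx frame_map frame1 (lker0_basis (lin_lker0 uM))// vbasis_full.
have L0 : lker (lin M) == 0%VS.
  by apply: (basis_lker0 vbasis_full MB) => i; rewrite frameE.
by have := lker0_unitmx L0; rewrite hommxK ?vbasis_full.
Qed.

Lemma lin_exists d e : basis_of {:V} d -> basis_of {:V} e ->
  exists G, lker G == 0%VS /\ map_tuple G d = e.
Proof.
move=> dB eB; pose G := hommx d e 1%:M.
have Gd (i : 'I_n) : G d`_i = e`_i.
  by rewrite hommxE// mulmx1 rVofE// vecof_delta.
exists G; split; first exact: (basis_lker0 dB eB Gd).
by apply: eq_from_tnth => i; rewrite tnth_map !(tnth_nth 0).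
Qed.

Lemma gram_mx (B : V -> V -> C) u v :
  (forall v, scalar (B^~ v)) -> (forall u, scalar (B u)) ->
  B u v = (rVof b u *m (\matrix_(i, j) B b`_i b`_j) *m (rVof b v)^T) 0 0.
Proof.
move=> Bl Br; rewrite (gram_sum u v vbasis_full Bl Br) -mulmxA mxE.
apply: eq_bigr => i _; rewrite !mxE mulr_sumr; apply: eq_bigr => j _.
by rewrite !mxE -!mulrA; congr (_ * _); rewrite mulrC.
Qed.

Variables (m : nat) (hn : nat -> nat).
Notation filt := (filtration m hn).
Implicit Types F : nat -> {vspace V}.

Lemma hdim_gt i : (m < i)%N -> hdim m hn i = 0%N.
Proof. by move=> mi; rewrite /hdim big_geq. Qed.

Lemma hdim_le i j : (i <= j)%N -> (hdim m hn j <= hdim m hn i)%N.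
Proof.
move=> ij; have [jm|mj] := leqP j m.+1; last by rewrite hdim_gt// ltnW.
by rewrite /hdim (big_cat_nat ij jm) leq_addl.
Qed.

(** Extend a basis of each step of the filtration to the next larger one. *)
Lemma filtration_flag F : hdim m hn 0 = n -> filt F ->
  exists d : n.-tuple V, flag_coord m hn d F.
Proof.
move=> h0 [F0 dF dimF].
have sz (U : {vspace V}) (s : seq V) : basis_of U s -> size s = \dim U :> nat.
  by move=> sB; rewrite (size_basis (X := in_tuple s) sB).
have chain k : (k <= m.+1)%N -> exists s : seq V, basis_of (F (m.+1 - k)%N) s /\
    forall i, (m.+1 - k <= i)%N -> F i = <<take (hdim m hn i) s>>%VS.
  elim: k => [_|k IHk km].
    rewrite subn0; have F0i i : (m < i)%N -> F i = 0%VS.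
      by move=> mi; apply/eqP; rewrite -dimv_eq0 dimF hdim_gt.
    exists [::]; split=> [|i mi]; first by rewrite F0i//; exact: nil_basis.
    by rewrite F0i//= span_nil.
  have [s [sB sF]] := IHk (ltnW km).
  have jS : (m.+1 - k)%N = (m.+1 - k.+1).+1 by rewrite subnSK.
  rewrite jS in sB sF; set j := (m.+1 - k.+1)%N in sB sF *.
  pose t := s ++ vbasis (F j :\: F j.+1).
  have tB : basis_of (F j) t.
    have -> : F j = (F j.+1 + (F j :\: F j.+1))%VS.
      by rewrite addvC addv_diff; apply/esym/addv_idPl.
    apply: cat_basis sB (vbasisP _).
    by apply/directv_addP; rewrite capvC capv_diff.
  exists t; split=> // i ji.
  have [ij|ij] := eqVneq i j.
    by rewrite ij take_oversize ?(span_basis tB)// (sz _ _ tB) dimF.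
  have ji' : (j < i)%N by rewrite ltn_neqAle eq_sym ij.
  rewrite take_cat (sz _ _ sB) dimF.
  case: ltnP => [_|hle]; first exact: sF.
  have := sF _ ji'; rewrite take_oversize ?(sz _ _ sB) ?dimF// => ->.
  by have /eqP -> : (hdim m hn i - hdim m hn j.+1 == 0)%N; rewrite ?take0 ?cats0//
    subn_eq0 hdim_le.
have [s] := chain m.+1 (leqnn _); rewrite subnn => -[sB sF].
rewrite F0 in sB; have /eqP ss := sz _ _ sB.
by exists (Tuple ss); split=> // i; apply: sF.
Qed.

Lemma flag_coord_uniq d F F' :
  flag_coord m hn d F -> flag_coord m hn d F' -> F = F'.
Proof. by move=> [_ e] [_ e']; apply/funext => i; rewrite e e'. Qed.

Lemma flag_coord_push d F G : lker G == 0%VS ->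
  flag_coord m hn d F -> flag_coord m hn (map_tuple G d) (push G F).
Proof.
move=> G0 [dB e]; split; first exact: lker0_basis.
by move=> i; rewrite /push e limg_span map_take.
Qed.

Lemma filtration_push F G : lker G == 0%VS -> filt F -> filt (push G F).
Proof.
move=> G0 [F0 dF dimF]; split=> [|i|i].
- by rewrite /push F0 lker0_limgf.
- by rewrite limgS.
- by rewrite limg_dim_eq ?dimF// (eqP G0) capv0.
Qed.

Variable Psi : 'M[int]_n.
Hypothesis Psi_sym : forall a b : 'cV[int]_n,
    intform Psi a b = (-1) ^+ m * intform Psi b a.
Hypothesis Psi_nondeg : int_nondegenerate Psi.

(** The orthogonals of the steps of [F] are known from its Hodge decomposition,
    so [F0] is first moved onto [F]; the two forms then differ by a self-adjoint
    automorphism preserving [F0], whose square root given by [mx_sqrt] turns the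
    first map into an isometry. *)
Lemma isotropic_conj (B : V -> V -> C) F0 (x : zform V) F :
  hdim m hn 0 = n ->
  typed_form Psi B -> polarized_lattice Psi x -> filt F0 -> filt F ->
  isotropic m F0 B -> isotropic m F (psiC n x) ->
  (\sum_(i < m.+1) hodge n m x F i)%VS = {:V}%VS ->
  exists G, [/\ lker G == 0%VS, forall u v, psiC n x (G u) (G v) = B u v &
    push G F0 = F].
Proof.
move=> h0 tB px fF0 fF iF0 iF sF.
have [d dF0] := filtration_flag h0 fF0; have [e eF] := filtration_flag h0 fF.
have [S [S0 Sd]] := lin_exists dF0.1 eF.1.
have SF : push S F0 = F.
  by apply: (flag_coord_uniq _ eF); rewrite -Sd; exact: flag_coord_push.
have py := polarized_act S0 px; set y := act x S in py.
have tB1 := psiC_typed py.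
pose Q0 : 'M[C]_n := \matrix_(i, j) B b`_i b`_j.
pose Q1 : 'M[C]_n := \matrix_(i, j) psiC n y b`_i b`_j.
have [Bl Br _] := tB.
have B0E u v : B u v = (rVof b u *m Q0 *m (rVof b v)^T) 0 0 by exact: gram_mx.
have B1E u v : psiC n y u v = (rVof b u *m Q1 *m (rVof b v)^T) 0 0.
  by apply: gram_mx; [exact: psiC_linl|exact: psiC_linr].
have Q0s : Q0 = (-1) ^+ m *: Q0^T.
  by apply/matrixP => i j; rewrite !mxE (typed_form_sym Psi_sym).
have Q1s : Q1 = (-1) ^+ m *: Q1^T.
  by apply/matrixP => i j; rewrite !mxE (typed_form_sym Psi_sym).
have nondeg_unit (B' : V -> V -> C) Q : typed_form Psi B' ->
    (forall u v, B' u v = (rVof b u *m Q *m (rVof b v)^T) 0 0) -> Q \in unitmx.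
  move=> tB' E; rewrite -row_free_unit -kermx_eq0; apply/eqP/row_matrixP => i.
  rewrite row0 -[LHS](vecofK vbasis_full).
  rewrite (_ : vecof b _ = 0) ?linear0//.
  apply: (typed_form_nondeg Psi_nondeg tB') => v.
  rewrite E vecofK ?vbasis_full// (_ : _ *m Q = 0) ?mul0mx ?mxE//.
  by apply/sub_kermxP; rewrite row_sub.
have uQ0 := nondeg_unit _ _ tB B0E; have uQ1 := nondeg_unit _ _ tB1 B1E.
(* The automorphism with B (u, v) = psi_y (Y u, v). *)
pose Y := Q0 *m invmx Q1.
have YQ : Y *m Q1 = Q0 by rewrite mulmxKV.
have uY : Y \in unitmx by rewrite unitmx_mul uQ0 unitmx_inv.
have nz2 : 2%:R != 0 :> C by rewrite pnatr_eq0.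
have YQT : Y *m Q1 = Q1 *m Y^T.
  by rewrite {2}Q1s -scalemxAl -trmx_mul YQ -Q0s.
have [L [LL LQ LW]] := mx_sqrt nz2 uY YQT.
have YF i : stablemx (msof b (F0 i)) Y.
  apply/rV_subP => _ /submxP[r ->].
  set r' := r *m msof b (F0 i).
  have r'F : vecof b r' \in F0 i by rewrite (mem_vecof vbasis_full) submxMl.
  rewrite mulmxA -[r *m _]/r' -(mem_vecof vbasis_full) -(memv_limg_inj _ _ S0).
  rewrite -[(S @: F0 i)%VS]/(push S F0 i) SF.
  apply: (perp_fil Psi_nondeg px _ iF sF); first by case: fF.
  move=> u; rewrite -SF => /memv_imgP[v vF ->].
  rewrite -(psiC_act _ _ S0 px) -/y B1E vecofK ?vbasis_full// -[r' *m Y *m Q1]mulmxA.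
  rewrite YQ -[r'](vecofK vbasis_full) -B0E.
  by apply: iF0 r'F vF; lia.
have uL : L \in unitmx by move: uY; rewrite -LL unitmx_mul andbb.
have L0 := lin_lker0 uL.
have rL w : rVof b (lin L w) = rVof b w *m L by rewrite (rVof_mul vbasis_full vbasis_full).
have LF i : (lin L @: F0 i)%VS = F0 i.
  apply/eqP; rewrite eqEdim limg_dim_eq ?(eqP L0) ?capv0// leqnn andbT.
  apply/subvP => _ /memv_imgP[v vF ->].
  rewrite -[lin L v](rVofK vbasis_full) (mem_vecof vbasis_full) rL.
  have := LW _ _ (YF i); apply: submx_trans.
  by rewrite submxMr// -(mem_vecof vbasis_full) rVofK ?vbasis_full.
exists (S \o lin L)%VF; split.
- exact: lker0_comp.
- move=> u v; rewrite !comp_lfunE -(psiC_act _ _ S0 px) -/y B1E B0E.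
  rewrite !rL trmx_mul -!mulmxA.
  by rewrite [Q1 *m _]mulmxA -LQ -mulmxA [L *m (L *m _)]mulmxA LL [Y *m _]mulmxA YQ.
- by apply/funext => i; rewrite /push limg_comp LF -[RHS]/(F i) -SF.
Qed.

End Frames.

(** * Analytic quotients and local lifts *)

Section Transfer.
Variables (R : realType) (V : vectType R[i]).
Local Notation C := R[i].
Local Notation n := (\dim {:V}).
Implicit Types (d e : n.-tuple V) (G : 'End(V)) (M N : 'M[C]_n).

(** Bases as coordinates on a space with an action of the linear group that is
    compatible with the action on bases; the points having coordinates then form
    one orbit ([homogeneous_total]). *)
Definition homogeneous_coord (T : Type) (k : n.-tuple V -> T -> Prop) :=
  [/\ forall d t, k d t -> basis_of {:V} d,
      forall d t s, k d t -> k d s -> t = s &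
      forall G t, lker G == 0%VS ->
        exists s, forall d, k d t -> k (map_tuple G d) s].

Lemma coord_unitmx T k M (t : T) :
  homogeneous_coord k -> k (frame M) t -> M \in unitmx.
Proof. by move=> [kB _ _] /kB; rewrite frame_basis. Qed.

Lemma near_coord_unitmx T (k : n.-tuple V -> T -> Prop) M t :
  homogeneous_coord k -> k (frame M) t ->
  \forall N \near M, N \in unitmx.
Proof.
move=> hk kM; apply: (near_unitmx (f := fun N => N)); last exact: coord_unitmx hk kM.
exact: differentiable_mx_id.
Qed.

Lemma homogeneous_total T k M N (t : T) : homogeneous_coord k ->
  k (frame M) t -> N \in unitmx -> exists s, k (frame N) s.
Proof.
move=> hk kM uN; have uM := coord_unitmx hk kM; have [_ _ eq] := hk.
have uG : lker (lin (V := V) (invmx M *m N)) == 0%VS.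
  by apply: lin_lker0; rewrite unitmx_mul unitmx_inv uM.
by have [s /(_ _ kM)] := eq _ t uG; rewrite -frame_map mulKVmx//; exists s.
Qed.

(** Two bases of the same point differ by a matrix [M' M^-1] acting on the left;
    such a change of basis stabilizes the fibre over every point [s], because
    the action of the linear group is on the other side. *)
Lemma homogeneous_translate T k M M' N (t s : T) : homogeneous_coord k ->
  k (frame M) t -> k (frame M') t -> k (frame N) s ->
  k (frame (M' *m invmx M *m N)) s.
Proof.
move=> hk kM kM' kN; have uM := coord_unitmx hk kM.
have uN := coord_unitmx hk kN; have [_ uniq eq] := hk.
have uG : lker (lin (V := V) (invmx M *m N)) == 0%VS.
  by apply: lin_lker0; rewrite unitmx_mul unitmx_inv uM.
have [s' eqs] := eq _ t uG.
have := eqs _ kM; rewrite -frame_map mulKVmx// => kNs'.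
by have := eqs _ kM'; rewrite -frame_map mulmxA (uniq _ _ _ kNs' kN).
Qed.

(** The open set of points that the definition asks for consists of the points
    having one basis with a good neighbourhood; [homogeneous_translate] moves
    this neighbourhood to the other bases of the same point. *)
Lemma copenP T k (S A : set T) : homogeneous_coord k ->
  (forall t, S t -> exists M, k (frame M) t) ->
  copen (coord_space k S) A <->
  A `<=` S /\ forall M t, k (frame M) t -> A t ->
    \forall N \near M, forall s, k (frame N) s -> S s -> A s.
Proof.
move=> hk Sk; split=> [[W oW ->]|[AS nA]].
  split=> [t [] //|M t kM [St Ot]].
  have : nbhs M [set M | exists2 t : T, k (frame M) t & W t].
    by apply: open_nbhs_nbhs; split; [exact: oW | exists t].
  apply: filterS => N [s kN Os] s' kNs' Ss'; split=> //.
  by have [_ uniq _] := hk; rewrite (uniq _ _ _ kNs' kN).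
exists [set t | exists2 M, k (frame M) t &
  \forall N \near M, forall s, k (frame N) s -> S s -> A s]; last first.
  apply/seteqP; split=> [t At|t [St [M kM] ] ].
    have St := AS _ At; split=> //; have [M kM] := Sk _ St.
    by exists M => //; exact: nA At.
  by move=> /nbhs_singleton; exact.
rewrite openE => M [t kM [M' kM' nM']].
have uM := coord_unitmx hk kM.
pose f N := M' *m invmx M *m N.
have df N : differentiable f N.
  apply: differentiable_mulmx; first exact: differentiable_cst.
  exact: differentiable_mx_id.
have fM : f M = M' by rewrite /f mulmxKV.
have fE N : f N = M' *m invmx M *m N by [].
move: f df fM fE => f df fM fE.
rewrite -fM in nM'.
have near_f := differentiable_near (df M) (nbhs_interior nM').
have near_u := near_coord_unitmx hk kM.
apply: (@filterS _ (nbhs M) _ _ _ _ (filterI near_f near_u)) => N [nfN uN].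
have [s kNs] := homogeneous_total hk kM uN.
exists s => //; exists (f N) => //; by rewrite fE; exact: homogeneous_translate kM kM' kNs.
Qed.

Section Lift.
Variables (T1 T2 : Type).
Variables (k1 : n.-tuple V -> T1 -> Prop) (k2 : n.-tuple V -> T2 -> Prop).
Variables (S1 : set T1) (S2 : set T2) (rel : T1 -> T2 -> Prop).
Hypothesis hk1 : homogeneous_coord k1.
Hypothesis hk2 : homogeneous_coord k2.
Hypothesis Sk1 : forall t, S1 t -> exists M, k1 (frame M) t.
Hypothesis Sk2 : forall t, S2 t -> exists M, k2 (frame M) t.

(** A relation between points need not be a map, but its lift to bases is one,
    and the structure of both spaces is defined through bases. *)
Definition local_lift := forall M t, k1 (frame M) t -> S1 t ->
  exists f : 'M[C]_n -> 'M[C]_n, \forall N \near M,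
    differentiable f N /\
    forall s, k1 (frame N) s -> S1 s ->
      exists s', [/\ k2 (frame (f N)) s', S2 s' & rel s s'].

Hypothesis lift : local_lift.
Variables (A1 : set T1) (A2 : set T2).
Hypothesis AS1 : A1 `<=` S1.
Hypothesis A12 : forall s s', rel s s' -> S1 s -> S2 s' -> A1 s <-> A2 s'.

Lemma lift_copen :
  copen (coord_space k2 S2) A2 -> copen (coord_space k1 S1) A1.
Proof.
move=> /(copenP _ hk2 Sk2)[_ nA2]; apply/(copenP _ hk1 Sk1).
split=> // M t kM At; have St := AS1 At.
have [f nf] := lift kM St.
have [df /(_ _ kM St)[t' [kt' St' tt']]] := nbhs_singleton nf.
have At' : A2 t' by apply/(A12 tt').
have nA := differentiable_near df (nA2 _ _ kt' At').
apply: (@filterS _ (nbhs M) _ _ _ _ (filterI nf nA)) => N [[_ fN] AN] s kNs Ss.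
have [s' [ks' Ss' ss']] := fN s kNs Ss.
by apply/(A12 ss') => //; exact: AN.
Qed.

Lemma lift_chol (f1 : T1 -> C) (f2 : T2 -> C) :
  (forall s s', rel s s' -> f1 s = f2 s') ->
  chol (coord_space k2 S2) A2 f2 -> chol (coord_space k1 S1) A1 f1.
Proof.
move=> f12 h2 M t kM At; have St := AS1 At.
have [f nf] := lift kM St.
have [df /(_ _ kM St)[t' [kt' St' tt']]] := nbhs_singleton nf.
have At' : A2 t' by apply/(A12 tt').
have [B [g [oB BfM dg gE]]] := h2 _ _ kt' At'.
have nB : nbhs (f M) B by exact: open_nbhs_nbhs.
have nfB := differentiable_near df nB.
have [B1 [oB1 B1M B1P]] := nbhs_open_sub (filterI nf nfB).
exists B1, (fun N => g (f N)). split.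
- exact: oB1.
- exact: B1M.
- move=> N /B1P[[dfN _] BN].
  exact: (@differentiable_comp _ _ _ _ f g N dfN (dg _ BN)).
- move=> N s /B1P[[_ fN] BN] kNs As; have Ss := AS1 As.
  have [s' [ks' Ss' ss']] := fN s kNs Ss.
  by rewrite (f12 _ _ ss'); apply: gE => //; apply/(A12 ss').
Qed.

End Lift.

(** Open sets and holomorphic functions on the quotients are invariant ones
    upstairs.  They are pulled back along the local lifts, in one direction by
    the lifts of [beta] and in the other by those of its inverse. *)
Lemma quot_analytic_iso (T1 T2 : Type)
    (k1 : n.-tuple V -> T1 -> Prop) (k2 : n.-tuple V -> T2 -> Prop)
    (S1 : set T1) (S2 : set T2) (orb1 : T1 -> set T1) (orb2 : T2 -> set T2)
    (beta : set T1 -> set T2) :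
  homogeneous_coord k1 -> homogeneous_coord k2 ->
  (forall t, S1 t -> exists M, k1 (frame M) t) ->
  (forall t, S2 t -> exists M, k2 (frame M) t) ->
  set_bij [set orb1 x | x in S1] [set orb2 x | x in S2] beta ->
  local_lift k1 k2 S1 S2 (fun x y => beta (orb1 x) = orb2 y) ->
  local_lift k2 k1 S2 S1 (fun y x => beta (orb1 x) = orb2 y) ->
  @analytic_iso R (@quot_space R (coord_space k1 S1) orb1)
    (@quot_space R (coord_space k2 S2) orb2) beta.
Proof.
move=> hk1 hk2 Sk1 Sk2 bij l12 l21.
pose P1 (A : set (set T2)) :=
  S1 `&` orb1 @^-1` ([set orb1 x | x in S1] `&` beta @^-1` A).
pose P2 (A : set (set T2)) := S2 `&` orb2 @^-1` A.
have A12 A s s' : beta (orb1 s) = orb2 s' -> S1 s -> S2 s' -> P1 A s <-> P2 A s'.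
  move=> e Ss Ss'; rewrite /P1 /P2 /setI/= e.
  by split=> [[_ [_ ?]]|[_ ?]]; split=> //; split=> //; exists s.
have A21 A s s' : beta (orb1 s') = orb2 s -> S2 s -> S1 s' -> P2 A s <-> P1 A s'.
  by move=> e Ss Ss'; apply: iff_sym; exact: A12.
have P1S A : P1 A `<=` S1 by move=> x [].
have P2S A : P2 A `<=` S2 by move=> x [].
split=> // [A AS|A f [AS _]].
  rewrite /quot_space/=; split=> [[_ oA]|[_ oA]].
    split; first by move=> o [].
    exact: (lift_copen hk1 hk2 Sk1 Sk2 l12 (P1S A) (A12 A)) oA.
  split=> //.
  exact: (lift_copen hk2 hk1 Sk2 Sk1 l21 (P2S A) (A21 A)) oA.
split; [apply: (lift_chol l12 (P1S A) (A12 A)) | apply: (lift_chol l21 (P2S A) (A21 A))].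
- by move=> s s' /= <-.
- by move=> s s' /= <-.
Qed.

End Transfer.

(** * Markings and the period map *)

Section Coords.
Variables (R : realType) (V : vectType R[i]).
Local Notation C := R[i].
Local Notation n := (\dim {:V}).
Implicit Types (d e : n.-tuple V) (G : 'End(V)).
Variables (m : nat) (hn : nat -> nat) (Psi : 'M[int]_n).

Lemma nth_map_tuple d G (i : 'I_n) : (map_tuple G d)`_i = G d`_i.
Proof. by rewrite (nth_map 0) ?size_tuple. Qed.

Lemma lattice_coord_map d y G : lker G == 0%VS -> lattice_coord Psi d y ->
  lattice_coord Psi (map_tuple (G^-1)%VF d) (act y G).
Proof.
move=> G0 [py zy fy]; split; [exact: polarized_act | exact: act_zbasis |].
move=> i j; rewrite -[Defs.form _ _ _]/(Defs.form y (G _) (G _)).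
by rewrite !nth_map_tuple !lker0_lfunVK.
Qed.

(** An automorphism [G] maps the lattice [x] to the pull-back of [x] by the
    inverse of [G]. *)
Lemma lattice_homogeneous : homogeneous_coord (@lattice_coord R V n Psi).
Proof.
split=> [d x [_ [] //]|d x y dx dy|G x G0].
  by have [_ ->] := lattice_coord_act dx dy (fun i => id_lfunE _); rewrite act1.
have G'0 := lker0_inv G0; exists (act x (G^-1)%VF) => d dx.
have := lattice_coord_map G'0 dx; congr (lattice_coord _ _ _).
apply: val_inj => /=; apply: eq_map => v.
by apply: (lker0P G'0); rewrite lker0_lfunVK// lker0_lfunK.
Qed.

Lemma flag_homogeneous : homogeneous_coord (@flag_coord R V n m hn).
Proof.
split=> [d x []//|d F F' |G F G0]; first exact: flag_coord_uniq.
by exists (push G F) => d; exact: flag_coord_push.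
Qed.

End Coords.

Section Main.
Variables (R : realType) (V : vectType R[i]).
Local Notation C := R[i].
Local Notation n := (\dim {:V}).
Local Notation b := (vbasis {:V}).
Implicit Types (x y : zform V) (d e : n.-tuple V) (G : 'End(V)) (u v w : V).
Implicit Types (M N : 'M[C]_n).
Variables (m : nat) (Psi : 'M[int]_n).
Hypothesis Psi_sym : forall a b : 'cV[int]_n,
    intform Psi a b = (-1) ^+ m * intform Psi b a.
Hypothesis Psi_nondeg : int_nondegenerate Psi.
Variable (hn : nat -> nat).
Hypothesis hn_sum : hdim m hn 0 = n.
Variables (F0 : nat -> {vspace V}) (psi0 : V -> V -> C) (x0 : zform V).
Hypothesis fF0 : filtration m hn F0.
Hypothesis tpsi0 : typed_form Psi psi0.
Hypothesis iF0 : isotropic m F0 psi0.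
Hypothesis px0 : polarized_lattice Psi x0.

Local Notation U := (@Uset R V n m Psi F0 psi0).
Local Notation D := (@Dset R V n m hn x0).
Local Notation orbG := (@G0_orbit R V F0 psi0).
Local Notation orbD := (@Gamma_orbit R V n x0).

(** The isometries from [psi0] to the form of [x0] that map [F0] to a point of
    [D]; both [U] and [D] are quotients of this set. *)
Definition marking G := [/\ lker G == 0%VS,
  forall u v, psiC n x0 (G u) (G v) = psi0 u v & D (push G F0)].

Lemma markingP G : lker G == 0%VS -> U (act x0 G) <-> marking G.
Proof.
move=> G0; split=> [[_ e dec pos]|[_ e [_ _ dec pos]]].
  split=> // [u v|]; first by rewrite -(psiC_act _ _ G0 px0).
  split.
  - exact: filtration_push.
  - move=> i j ij _ _ /memv_imgP[u uF ->] /memv_imgP[v vF ->].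
    by rewrite -(psiC_act _ _ G0 px0) e; exact: iF0 ij _ _ uF vF.
  - exact/(hodge_decomposition_act _ _ G0 px0).
  - exact/(hodge_positive_act _ _ G0 px0).
split.
- exact: polarized_act.
- by move=> u v; rewrite (psiC_act _ _ G0 px0).
- exact/(hodge_decomposition_act _ _ G0 px0).
- exact/(hodge_positive_act _ _ G0 px0).
Qed.

Lemma x0_typed_basis : exists d0, lattice_coord Psi d0 x0.
Proof. by have [[d zd fd] _ _ _] := px0; exists d; split. Qed.

Lemma U_marking x : U x -> exists2 G, marking G & x = act x0 G.
Proof.
move=> Ux; have [[[d zd fd] _ _ _] _ _ _] := Ux.
have [px _ _ _] := Ux.
have [d0 cd0] := x0_typed_basis; have [_ [d0B _] _] := cd0.
have [G [G0 Gd]] := lin_exists zd.1 d0B.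
have cd : lattice_coord Psi d x by split.
have [_ e] := lattice_coord_act (G := G) cd cd0 (fun i => etrans (esym (nth_map_tuple d G i)) (congr1 (fun t : n.-tuple V => t`_i) Gd)).
by exists G => //; apply/(markingP G0); rewrite -e.
Qed.

Lemma D_marking F : D F -> exists2 G, marking G & push G F0 = F.
Proof.
move=> DF; have [fF iF [sF _] _] := DF.
have [G [G0 eG GF]] := isotropic_conj Psi_sym Psi_nondeg hn_sum tpsi0 px0 fF0 fF iF0 iF sF.
by exists G => //; split=> //; rewrite GF.
Qed.

(** Isometries of a nondegenerate form are injective. *)
Lemma G0_lker0 f : G0 F0 psi0 f -> lker f == 0%VS.
Proof.
move=> [_ e]; rewrite -subv0; apply/subvP => v; rewrite memv_ker memv0 => /eqP fv.
apply/eqP/(typed_form_nondeg Psi_nondeg tpsi0) => u.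
have [Bl _ _] := tpsi0.
by rewrite -e fv; have := Bl (f u) (-1) 0 0; rewrite scaler0 add0r mulN1r addNr.
Qed.

Lemma push_comp G (H : 'End(V)) (F : nat -> {vspace V}) :
  push (G \o H)%VF F = push G (push H F).
Proof. by apply/funext => i; rewrite /push limg_comp. Qed.

Lemma push_id (F : nat -> {vspace V}) : push \1%VF F = F.
Proof. by apply/funext => i; rewrite /push lim1g. Qed.

Lemma pushK G (F : nat -> {vspace V}) : lker G == 0%VS -> push (G^-1)%VF (push G F) = F.
Proof. by move=> G0; rewrite -push_comp lker0_compVf// push_id. Qed.

Lemma push_G0 f : G0 F0 psi0 f -> push f F0 = F0.
Proof. by move=> [fF _]; apply/funext => i; exact: fF. Qed.

Lemma marking_G0 G (G' : 'End(V)) : marking G -> marking G' ->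
  push G F0 = push G' F0 -> G0 F0 psi0 (G^-1 \o G')%VF.
Proof.
move=> [G0' eG _] [G'0 eG' _] eF; split=> [i|u v].
  rewrite limg_comp -[(G' @: _)%VS]/(push G' F0 i) -eF.
  by rewrite -[LHS]/(push (G^-1)%VF (push G F0) i) pushK.
by rewrite -eG !comp_lfunE !lker0_lfunVK// eG'.
Qed.

(** The automorphisms of the lattice [x0], extended to [V], are the linear
    automorphisms that pull [x0] back to itself. *)
Lemma Gamma_orbitP F F' : orbD F F' <->
  exists K, [/\ lker K == 0%VS, act x0 K = x0 & F' = push K F].
Proof.
split=> [[g gP <-]|[K [K0 xK ->]]].
  by have [K0 e] := lattice_isom_lext px0 px0 gP; exists (lext n x0 g).
have zx := polarized_zb px0.
exists K; last by rewrite (lext_lin _ zx).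
by have := lattice_isom_act x0 K0; rewrite xK.
Qed.

Lemma Gamma_marking G K : lker K == 0%VS -> act x0 K = x0 -> marking G ->
  marking (K \o G)%VF.
Proof.
move=> K0 xK mG; have [G0' _ _] := mG.
by apply/(markingP (lker0_comp K0 G0')); rewrite -actM xK; apply/markingP.
Qed.

(** The period map on orbits, written without a choice of representatives. *)
Definition period_map (O : set (zform V)) : set (nat -> {vspace V}) :=
  [set push G F0 | G in [set G | marking G /\ O (act x0 G)]].

(** If [act x0 G'] is in the orbit of [act x0 G], then [G'] and [G f] define the
    same lattice for some [f] in [G0], so they differ by an automorphism of [x0];
    and [f] fixes [F0]. *)
Lemma period_mapE G : marking G -> period_map (orbG (act x0 G)) = orbD (push G F0).
Proof.
move=> mG; have [Gl _ _] := mG; apply/seteqP; split=> F.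
  move=> [G' [mG' [f Gf e]] <-]; have [G'l _ _] := mG'; have fl := G0_lker0 Gf.
  have Gfl := lker0_comp Gl fl.
  apply/Gamma_orbitP; exists (G' \o (G \o f)^-1)%VF; split.
  - exact: (lker0_comp G'l (lker0_inv Gfl)).
  - by rewrite -actM -e [act (act x0 G) f]actM actM lker0_compfV// act1.
  - have -> : push G F0 = push (G \o f)%VF F0 by rewrite push_comp (push_G0 Gf).
    by rewrite (push_comp G') pushK.
move/Gamma_orbitP => [K [K0 xK ->]].
exists (K \o G)%VF; last exact: push_comp.
split; first exact: Gamma_marking.
exists \1%VF; last by rewrite act1 -actM xK.
by split=> [i|u v]; rewrite ?lim1g// !id_lfunE.
Qed.

Lemma orbG_act x f : G0 F0 psi0 f -> orbG (act x f) = orbG x.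
Proof.
move=> Gf; have fl := G0_lker0 Gf; have [fF fe] := Gf.
apply/seteqP; split=> _ [g [gF ge] <-].
  exists (f \o g)%VF; last by rewrite actM.
  by split=> [i|u v]; rewrite ?limg_comp ?gF ?fF// !comp_lfunE fe ge.
exists (f^-1 \o g)%VF; last by rewrite actM lker0_compVKf.
split=> [i|u v]; first by rewrite limg_comp gF -[LHS]/(push _ F0 i) -{1}(push_G0 Gf) pushK.
by rewrite !comp_lfunE -fe !lker0_lfunVK.
Qed.

Lemma period_map_bij : set_bij [set orbG x | x in U] [set orbD F | F in D] period_map.
Proof.
split=> [_ [x Ux <-]|o o' /set_mem[x Ux <-] /set_mem[x' Ux' <-]|_ [F DF <-]].
- have [G mG ->] := U_marking Ux; rewrite period_mapE//.
  by exists (push G F0) => //; case: mG.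
- have [G mG ->] := U_marking Ux; have [G' mG' ->] := U_marking Ux'.
  rewrite !period_mapE// => e.
  have : orbD (push G F0) (push G' F0).
    rewrite e; apply/Gamma_orbitP; exists \1%VF.
    by rewrite act1 push_id -subv0; split=> //; apply/subvP => v; rewrite memv_ker id_lfunE memv0.
  move=> /Gamma_orbitP[K [K0 xK eF]].
  have mKG := Gamma_marking K0 xK mG.
  have := marking_G0 mKG mG'; rewrite push_comp -eF => /(_ erefl) Gf.
  have [KGl _ _] := mKG.
  rewrite -(orbG_act (act x0 G) Gf); congr (orbG _).
  by rewrite -{1}xK (actM x0 K G) actM lker0_compVKf.
- have [G mG <-] := D_marking DF; have [Gl _ _] := mG.
  by exists (orbG (act x0 G)); [exists (act x0 G) => //; exact/markingP | exact: period_mapE].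
Qed.

(** If the lattice has basis [N], its isomorphism with [x0] that maps [N] to [N0]
    has matrix [N^-1 N0]; it takes the adapted basis [E] of [F0] to
    [E N^-1 N0]. *)
Lemma lattice_lift : local_lift (@lattice_coord R V n Psi) (@flag_coord R V n m hn)
  U D (fun x F => period_map (orbG x) = orbD F).
Proof.
move=> M x cM Ux; have [d0 cd0] := x0_typed_basis.
have [E0 eE] := filtration_flag hn_sum fF0.
have [N0 N0d] := frame_surj d0; have [E Ee] := frame_surj E0; subst d0 E0.
have uN0 : N0 \in unitmx by exact: (coord_unitmx (lattice_homogeneous Psi) cd0).
exists (fun N => E *m adjinv N *m N0).
have near_u := near_coord_unitmx (lattice_homogeneous Psi) cM.
apply: (@filterS _ (nbhs M) _ _ _ _ near_u) => N uN; split.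
  apply: differentiable_mulmx; last exact: differentiable_cst.
  apply: differentiable_mulmx; first exact: differentiable_cst.
  by apply: differentiable_adjinv => //; exact: differentiable_mx_id.
move=> s cs Us; pose A := invmx N *m N0.
have uA : A \in unitmx by rewrite unitmx_mul unitmx_inv uN.
have [G0' e] := lattice_coord_act (G := lin A) cs cd0
  (fun i => etrans (esym (frame_lin N A i)) (congr1 (fun B => (frame B)`_i) (mulKVmx uN N0))).
have mG : marking (lin A) by apply/markingP => //; rewrite -e.
exists (push (lin A) F0); split; last 2 first.
- by case: mG.
- by rewrite e; exact: period_mapE.
rewrite adjinvE// -mulmxA frame_map; exact: flag_coord_push.
Qed.

(** Near the basis [P] of [F1] the linear map with matrix [Z = P^-1 N] takes [F1]
    to the flag of [N] and is close to the identity, so [unip] applies to it. *)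
Lemma flag_lift : local_lift (@flag_coord R V n m hn) (@lattice_coord R V n Psi)
  D U (fun F x => period_map (orbG x) = orbD F).
Proof.
move=> P F1 cP DF1; have [d0 cd0] := x0_typed_basis.
have [N0 N0d] := frame_surj d0; subst d0.
have uN0 : N0 \in unitmx by exact: (coord_unitmx (lattice_homogeneous Psi) cd0).
have uP := coord_unitmx (flag_homogeneous V m hn) cP.
have [fF1 iF1 [sF1 _] _] := DF1; have [_ dF1 _] := fF1.
have [G1 mG1 G1F] := D_marking DF1; have [G1l G1e _] := mG1.
pose A1 := mxof b b G1.
have uA1 : A1 \in unitmx by exact: lker0_unitmx.
pose Pi a := mxof b b (fproj sF1 a); pose H i := mxof b b (hproj sF1 i).
pose Z N := invmx P *m N.
(* [Cm a] is the operator that [W a] inverts, [Um] the matrix of [unip]. *)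
pose Cm (a : 'I_m.+1) N := Pi a *m Z N *m Pi a + (1%:M - Pi a).
pose Um N := \sum_(a < m.+1) H a *m adjinv (Cm a N) *m Z N.
have dZ N : differentiable Z N.
  by apply: differentiable_mulmx; [exact: differentiable_cst | exact: differentiable_mx_id].
have dC a N : differentiable (Cm a) N.
  apply: differentiableD; last exact: differentiable_cst.
  apply: differentiable_mulmx; last exact: differentiable_cst.
  by apply: differentiable_mulmx => //; exact: differentiable_cst.
have dU N : (forall a, Cm a N \in unitmx) -> differentiable Um N.
  move=> uC; apply: differentiable_fsum => a; apply: differentiable_mulmx => //.
  apply: differentiable_mulmx; first exact: differentiable_cst.
  exact: (differentiable_adjinv (uC a) (dC a N)).
have ZP : Z P = 1%:M by rewrite /Z mulVmx.
have CP a : Cm a P = 1%:M.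
  rewrite /Cm ZP mulmx1.
  have -> : Pi a *m Pi a = Pi a.
    rewrite /Pi -mxof_comp ?vbasis_full//; congr mxof; apply/lfunP => v.
    by rewrite comp_lfunE (fproj_id Psi_nondeg px0 dF1 iF1)// (fproj_fil px0).
  by rewrite addrC subrK.
have UP : Um P = 1%:M.
  have -> : Um P = \sum_(a < m.+1) H a.
    apply: eq_bigr => a _; rewrite CP ZP adjinvE ?unitmx1//.
    by rewrite invmx1 !mulmx1.
  apply: (can_inj (hommxK (vbasis_full V) (vbasis_full V))).
  rewrite -[LHS]/(lin _) -[RHS]/(lin _) lin_sum lin1; apply/lfunP => v.
  rewrite sum_lfunE id_lfunE -[RHS](hproj_sum sF1).
  by apply: eq_bigr => a _; rewrite lin_mxof.
have near_C : \forall N \near P, forall a, Cm a N \in unitmx.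
  apply: (@filter_forall _ _ _ (nbhs P)) => a.
  have C1 : Cm a P \in unitmx by rewrite CP unitmx1.
  exact: (near_unitmx (dC a P) C1).
have near_U : \forall N \near P, Um N \in unitmx.
  have U1 : Um P \in unitmx by rewrite UP unitmx1.
  have C1 a : Cm a P \in unitmx by rewrite CP unitmx1.
  exact: (near_unitmx (dU P C1) U1).
have near_u := near_coord_unitmx (flag_homogeneous V m hn) cP.
exists (fun N => N0 *m adjinv (A1 *m Um N)).
apply: (@filterS _ (nbhs P) _ _ _ _ (filterI near_u (filterI near_C near_U))) => N [uN [uC uU]].
have uAU : A1 *m Um N \in unitmx by rewrite unitmx_mul uA1.
split.
  apply: differentiable_mulmx; first exact: differentiable_cst.
  apply: differentiable_adjinv => //.
  by apply: differentiable_mulmx; [exact: differentiable_cst | exact: dU].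
move=> F cF DF; have [fF iF _ _] := DF; have [_ dF _] := fF.
have uZ : Z N \in unitmx by rewrite unitmx_mul unitmx_inv uP.
have ZF : push (lin (Z N)) F1 = F.
  apply: flag_coord_uniq cF; have := flag_coord_push (lin_lker0 uZ) cP.
  by rewrite -frame_map mulKVmx.
pose W a := lin (V := V) (adjinv (Cm a N)).
have TF a : (lin (Z N) @: F1 a <= F a)%VS by rewrite -ZF.
have WP (a : 'I_m.+1) v : fproj sF1 a (lin (Z N) (fproj sF1 a (W a v))) +
    (W a v - fproj sF1 a (W a v)) = v.
  have : lin (adjinv (Cm a N) *m Cm a N) v = v.
    by rewrite (adjinvE (uC a)) (mulVmx (uC a)) lin1 id_lfunE.
  rewrite linM comp_lfunE -/(W a) => e; rewrite -[RHS]e.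
  rewrite /Cm linD linB !add_lfunE opp_lfunE lin1 id_lfunE.
  rewrite (linM (Pi a *m Z N)) (linM (Pi a)) !(lin_mxof (fproj sF1 a)).
  by rewrite !comp_lfunE.
have linU : lin (Um N) = unip sF1 (lin (Z N)) W.
  rewrite lin_sum; apply: eq_bigr => i _.
  by rewrite (linM (H i *m _)) (linM (H i)) (lin_mxof (hproj sF1 i)) comp_lfunA.
have Ul : lker (lin (Um N)) == 0%VS by exact: lin_lker0.
have UF : push (lin (Um N)) F1 = F.
  apply/funext => i; apply/eqP; rewrite eqEdim.
  rewrite {1}linU (unip_fil Psi_nondeg px0 dF1 iF1 TF dF WP)/=.
  rewrite limg_dim_eq ?(eqP Ul) ?capv0//.
  by have [_ _ ->] := fF; have [_ _ ->] := fF1.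
have AUE : lin (A1 *m Um N) = (lin (Um N) \o G1)%VF.
  by rewrite linM /lin mxofK ?vbasis_full.
have AUl := lin_lker0 uAU.
have mG : marking (lin (A1 *m Um N)).
  split=> //; last by rewrite AUE push_comp G1F UF.
  move=> u v; rewrite AUE !comp_lfunE linU.
  by rewrite (unip_isom Psi_nondeg px0 dF1 iF1 TF iF WP).
exists (act x0 (lin (A1 *m Um N))); split.
- rewrite (adjinvE uAU); set A := A1 *m Um N in uAU AUl *.
  have := lattice_coord_map AUl cd0.
  by rewrite -lin_inv// -frame_map.
- exact/markingP.
- by rewrite period_mapE// AUE push_comp G1F UF.
Qed.

End Main.

Theorem proposition3 (R : realType) (V0 : vectType R[i]) (h m : nat)
  (dimV0 : \dim {:V0} = h)
  (Psi0 : 'M[int]_h)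
  (Psi0_sym : forall a b : 'cV[int]_h,
    intform Psi0 a b = (-1) ^+ m * intform Psi0 b a)
  (Psi0_nondeg : int_nondegenerate Psi0)
  (hn : nat -> nat) (hn_sum : hdim m hn 0 = h)
  (F0 : nat -> {vspace V0}) (F0_filtration : filtration m hn F0)
  (psi0 : {biscalar V0})
  (psi0_type : exists2 d : h.-tuple V0, basis_of {:V0} d &
    forall i j : 'I_h, psi0 d`_i d`_j = (Psi0 i j)%:~R)
  (psi0_F0 : isotropic m F0 psi0)
  (x0 : zform V0) (x0L : polarized_lattice Psi0 x0) :
  (forall x, Uset m Psi0 F0 psi0 x -> exists gamma, lattice_isom x x0 gamma) /\
  exists beta : pts (U_mod_G0 m Psi0 F0 psi0) -> pts (Gamma_mod_D h m hn x0),
    analytic_iso beta /\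
    forall x gamma, Uset m Psi0 F0 psi0 x -> lattice_isom x x0 gamma ->
      beta (G0_orbit F0 psi0 x) =
      Gamma_orbit h x0 (push (lext h x gamma) F0).
Proof.
subst h; set psi : V0 -> V0 -> R[i] := psi0.
have tpsi : typed_form Psi0 psi.
  split=> // [v a u w|u a v w]; first exact: linearPl.
  exact: linearPr.
split=> [x Ux|].
  have [G mG ->] := U_marking F0_filtration psi0_F0 x0L Ux; have [Gl _ _] := mG.
  by exists G; exact: lattice_isom_act.
exists (period_map m hn F0 psi x0); split.
  apply: quot_analytic_iso.
  - exact: lattice_homogeneous.
  - exact: flag_homogeneous.
  - move=> x [[[d zd fd] fl fr f0] _ _ _]; have [M Md] := frame_surj d.
    by exists M; rewrite Md; split=> //; split=> //; exists d.
  - move=> F [fF _ _ _]; have [d dF] := filtration_flag hn_sum fF.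
    by have [M Md] := frame_surj d; exists M; rewrite Md.
  - exact: period_map_bij.
  - exact: lattice_lift.
  - exact: flag_lift.
move=> x g Ux gP; have [px _ _ _] := Ux.
have [Gl e] := lattice_isom_lext px x0L gP.
have mG : marking m hn F0 psi x0 (lext (\dim {:V0}) x g).
  by apply/(markingP F0_filtration psi0_F0 x0L Gl); rewrite -e.
rewrite {1}e; exact: period_mapE.
Qed.
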